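(* Let $\alpha\in\mathbb{N}$. There is a constant $c_\alpha>0$ such that the following holds for every $d\in\mathbb{N}$ and every choice of numbers of nodes $(n_\ell)_{\ell\ge1}$ of the univariate Gauss--Hermite rules. Let $\Lambda\subset\mathbb{N}^d$ be a nonempty finite index set that is downward-closed in one direction, let $S_\Lambda$ be the corresponding sparse-grid quadrature based on the Gauss--Hermite rule, and let $N$ be the total number of point evaluations used in $S_\Lambda$. Then $$\sup_{0\ne f\in H^\alpha_\rho(\mathbb{R}^d)}\frac{|I(f)-S_\Lambda(f)|}{\|f\|_{H^\alpha_\rho(\mathbb{R}^d)}}\ \ge\ c_\alpha N^{-\alpha/2}.$$ In particular the constant $c_\alpha$ is independent of $N$ and $d$.
   Context: $\mathbb{N}=\{1,2,\dots\}$. Let $\rho(\boldsymbol{x})=(2\pi)^{-d/2}e^{-|\boldsymbol{x}|_2^2/2}$ be the standard Gaussian density on $\mathbb{R}^d$ ($|\cdot|_2$ the Euclidean norm), and $I(f)=\int_{\mathbb{R}^d}f(\boldsymbol{x})\rho(\boldsymbol{x})\,d\boldsymbol{x}$. $L^2_\rho(\mathbb{R}^d)$ is the $L^2$ space with respect to $\rho\,d\boldsymbol{x}$. The Gaussian Sobolev space $H^\alpha_\rho(\mathbb{R}^d)$ of dominating mixed smoothness $\alpha$ consists of all $f$ whose weak derivatives $D^{\mathbf{r}}f$ lie in $L^2_\rho(\mathbb{R}^d)$ for all $\mathbf{r}\in\mathbb{N}_0^d$ with $|\mathbf{r}|_\infty\le\alpha$, with norm $\|f\|_{H^\alpha_\rho(\mathbb{R}^d)}=\big(\sum_{|\mathbf{r}|_\infty\le\alpha}\|D^{\mathbf{r}}f\|^2_{L^2_\rho(\mathbb{R}^d)}\big)^{1/2}$.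 Functions in this space have continuous representatives, at which point evaluations are taken. For $\ell\ge1$ let $Q^{\mathrm{uni}}_\ell$ be the univariate Gauss--Hermite rule with $n_\ell\in\mathbb{N}$ nodes, i.e. the Gauss quadrature $Q^{\mathrm{uni}}_\ell(g)=\sum_{i=1}^{n_\ell}w_ig(\xi_i)$ for the standard Gaussian weight on $\mathbb{R}$, whose nodes are the zeros of the probabilists' Hermite polynomial of degree $n_\ell$ and which is exact for polynomials of degree at most $2n_\ell-1$. Put $Q^{\mathrm{uni}}_0=0$, $\Delta_0=0$ and $\Delta_\ell=Q^{\mathrm{uni}}_\ell-Q^{\mathrm{uni}}_{\ell-1}$ for $\ell\ge1$. For finite $\Lambda\subset\mathbb{N}^d$ the sparse-grid quadrature is $$S_\Lambda=\sum_{(\ell_1,\dots,\ell_d)\in\Lambda}\Delta_{\ell_1}\otimes\cdots\otimes\Delta_{\ell_d},$$ where the tensor product of univariate functionals $\sum_i w^{(j)}_i\,\delta_{x^{(j)}_i}$, $j=1,\dots,d$, is $f\mapsto\sum_{i_1,\dots,i_d}w^{(1)}_{i_1}\cdots w^{(d)}_{i_d}f(x^{(1)}_{i_1},\dots,x^{(d)}_{i_d})$. $N$ is the number of distinct points of $\mathbb{R}^d$ at which $f$ is evaluated in $S_\Lambda(f)$. $\Lambda$ is downward-closed in one direction if there is a coordinate index $j\in\{1,\dots,d\}$ such that whenever $(1,\dots,1,\ell,1,\dots,1)\in\Lambda$, with $\ell$ in the $j$-th position, then $(1,\dots,1,k,1,\dots,1)\in\Lambda$ (with $k$ in the $j$-th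 position) for all integers $1\le k\le\ell$. *)

(* Defs.v *)
From HB Require Import structures.
From mathcomp Require Import all_boot all_order all_algebra finmap.
From mathcomp Require Import all_classical all_reals all_analysis.

Set Implicit Arguments.
Unset Strict Implicit.
Unset Printing Implicit Defensive.

Import Order.TTheory GRing.Theory Num.Theory.
Import numFieldNormedType.Exports.

Local Open Scope classical_set_scope.
Local Open Scope ring_scope.

(* Row vectors carry the sigma-algebra generated by the coordinate maps, i.e.
   the Borel sigma-algebra of R^n. *)
Section measurable_rV.
Context {R : realType} (n : nat).

Let coors : 'I_n -> 'rV[R]_n -> measurableTypeR R := fun i x => x 0 i.

Let rV_set0 : g_sigma_preimage coors set0.
Proof. exact: sigma_algebra0. Qed.

Let rV_setC A : g_sigma_preimage coors A -> g_sigma_preimage coors (~` A).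
Proof. exact: sigma_algebraC. Qed.

Let rV_bigcup (F : (set 'rV[R]_n)^nat) :
  (forall i, g_sigma_preimage coors (F i)) ->
  g_sigma_preimage coors (\bigcup_i F i).
Proof. exact: sigma_algebra_bigcup. Qed.

HB.instance Definition _ := @isMeasurable.Build default_measure_display
  'rV[R]_n (g_sigma_preimage coors) rV_set0 rV_setC rV_bigcup.

End measurable_rV.

Lemma measurable_rV_coord (R : realType) n (i : 'I_n) :
  measurable_fun [set: 'rV[R]_n] (fun x => x 0 i : measurableTypeR R).
Proof.
move=> _ Y mY; rewrite setTI; apply: sub_sigma_algebra => /=.
rewrite -bigcup_seq/=; exists i => /=; first by rewrite mem_index_enum.
by exists Y => //; rewrite setTI.
Qed.

Lemma measurable_fun_rVP (R : realType) d (T : measurableType d) n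
    (f : T -> 'rV[R]_n) :
  (forall i, measurable_fun setT (fun t => f t 0 i : measurableTypeR R)) ->
  measurable_fun setT f.
Proof.
move=> mf; apply: (@measurability _ _ _ _ setT f
  (\big[setU/set0]_(i < n) preimage_set_system setT
     (fun x : 'rV[R]_n => x 0 i : measurableTypeR R) measurable)) => //.
move=> _ [A + <-]; rewrite -bigcup_seq => -[i _ [B mB <-]].
rewrite !setTI; have := mf i measurableT B mB; by rewrite setTI.
Qed.

Section lebesgue_step.
Context {R : realType} (n : nat).

Definition rV_cons (p : measurableTypeR R * 'rV[R]_n) : 'rV[R]_n.+1 :=
  \row_i if unlift ord0 i is Some j then p.2 0 j else p.1.

Lemma rV_cons0 p : rV_cons p 0 ord0 = p.1.
Proof. by rewrite mxE unlift_none. Qed.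

Lemma rV_consS p i : rV_cons p 0 (lift ord0 i) = p.2 0 i.
Proof. by rewrite mxE liftK. Qed.

Lemma measurable_rV_cons : measurable_fun setT rV_cons.
Proof.
apply: measurable_fun_rVP => i; case: (unliftP ord0 i) => [j ->|->].
  under eq_fun do rewrite rV_consS.
  exact: (measurableT_comp (measurable_rV_coord j)).
by under eq_fun do rewrite rV_cons0; exact: measurable_fst.
Qed.

Variable mu : {sigma_finite_measure set 'rV[R]_n -> \bar R}.

Definition lebesgue_rVS : set 'rV[R]_n.+1 -> \bar R :=
  pushforward (@lebesgue_measure R \x mu)%E rV_cons.

Let lebesgue_rVS0 : lebesgue_rVS set0 = 0%E.
Proof. by rewrite /lebesgue_rVS /pushforward preimage_set0 measure0. Qed.

Let lebesgue_rVS_ge0 A : (0 <= lebesgue_rVS A)%E.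
Proof. by rewrite /lebesgue_rVS /pushforward measure_ge0. Qed.

Let lebesgue_rVS_sigma_additive : semi_sigma_additive lebesgue_rVS.
Proof.
move=> F mF tF mUF; rewrite /lebesgue_rVS /pushforward preimage_bigcup.
apply: measure_semi_sigma_additive.
- by move=> k; rewrite -[X in measurable X]setTI; exact: measurable_rV_cons.
- apply/trivIsetP => /= i j _ _ ij; rewrite -preimage_setI.
  by move/trivIsetP : tF => /(_ _ _ _ _ ij) ->//; rewrite preimage_set0.
- rewrite -preimage_bigcup -[X in measurable X]setTI.
  exact: measurable_rV_cons.
Qed.

HB.instance Definition _ := isMeasure.Build _ _ _ lebesgue_rVS
  lebesgue_rVS0 lebesgue_rVS_ge0 lebesgue_rVS_sigma_additive.

Definition rV_uncons (x : 'rV[R]_n.+1) : measurableTypeR R * 'rV[R]_n :=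
  (x 0 ord0, \row_i x 0 (lift ord0 i)).

Lemma rV_consK : cancel rV_cons rV_uncons.
Proof.
case=> a v; congr pair; first by rewrite rV_cons0.
by apply/rowP => i; rewrite mxE rV_consS.
Qed.

Lemma measurable_rV_uncons : measurable_fun setT rV_uncons.
Proof.
apply: measurable_fun_pair; first exact: measurable_rV_coord.
apply: measurable_fun_rVP => i.
by under eq_fun do rewrite mxE; exact: measurable_rV_coord.
Qed.

Let lebesgue_rVS_sigma_finite : sigma_finite setT lebesgue_rVS.
Proof.
have /sigma_finiteP[F [TF ndF Foo]] := sigma_finiteT (@lebesgue_measure R).
have /sigma_finiteP[G [TG ndG Goo]] := sigma_finiteT mu.
exists (fun k => rV_uncons @^-1` (F k `*` G k)).
  apply/esym/seteqP; split => // x _.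
  have [k _ Fk] : (\bigcup_i F i) (rV_uncons x).1 by rewrite -TF.
  have [l _ Gl] : (\bigcup_i G i) (rV_uncons x).2 by rewrite -TG.
  exists (maxn k l) => //; split.
  - by move: Fk; exact/subsetPset/ndF/leq_maxl.
  - by move: Gl; exact/subsetPset/ndG/leq_maxr.
move=> k; have [mF Fk] := Foo k; have [mG Gk] := Goo k; split.
  by rewrite -[X in measurable X]setTI; apply: measurable_rV_uncons => //;
    exact: measurableX.
rewrite /lebesgue_rVS /pushforward -comp_preimage.
rewrite (_ : rV_uncons \o rV_cons = id); last first.
  by apply/funext => p; exact: rV_consK.
by rewrite preimage_id product_measure1E// lte_mul_pinfty// ge0_fin_numE.
Qed.

HB.instance Definition _ := Measure_isSigmaFinite.Build _ _ _ lebesgue_rVS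
  lebesgue_rVS_sigma_finite.

End lebesgue_step.

Fixpoint lebesgue_rV (R : realType) (n : nat) :
    {sigma_finite_measure set 'rV[R]_n -> \bar R} :=
  match n with
  | 0 => [the {sigma_finite_measure set 'rV[R]_0 -> \bar R} of \d_ (0 : 'rV[R]_0)]
  | n'.+1 => [the {sigma_finite_measure set 'rV[R]_n'.+1 -> \bar R} of
               lebesgue_rVS (lebesgue_rV R n')]
  end.

Section gauss.
Context {R : realType} (d : nat).
Implicit Types (f g phi : 'rV[R]_d -> R) (x : 'rV[R]_d).

(* `|x| on matrices is the maximum norm in the library. *)
Definition eucl_norm x : R := Num.sqrt (\sum_i x 0 i ^+ 2).

Definition gauss_rho x : R :=
  (2 * pi) `^ (- (d%:R / 2)) * expR (- (eucl_norm x ^+ 2 / 2)).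

Definition gauss_int f : R := \int[lebesgue_rV R d]_x (f x * gauss_rho x).

Definition gauss_L2 f : Prop :=
  measurable_fun setT f /\
  (\int[lebesgue_rV R d]_x (f x ^+ 2 * gauss_rho x)%:E < +oo)%E.

Definition gauss_L2norm f : R :=
  Num.sqrt (\int[lebesgue_rV R d]_x (f x ^+ 2 * gauss_rho x)).

(* iterated partial derivatives along the listed coordinate directions *)
Definition partials (s : seq 'I_d) phi : 'rV[R]_d -> R :=
  foldr (fun i g x => 'D_(delta_mx 0 i) g x) phi s.

Definition test_function phi : Prop :=
  [/\ forall s x (i : 'I_d), derivable (partials s phi) x (delta_mx 0 i),
      forall s, continuous (partials s phi) &
      compact (closure [set x | phi x != 0])].

Definition multi_partial (r : 'I_d -> nat) phi : 'rV[R]_d -> R :=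
  partials (flatten [seq nseq (r i) i | i <- enum 'I_d]) phi.

(* Meant for f and g locally integrable. *)
Definition weak_derivative (r : 'I_d -> nat) f g : Prop :=
  forall phi, test_function phi ->
    \int[lebesgue_rV R d]_x (f x * multi_partial r phi x) =
    (-1) ^+ (\sum_i r i)%N * \int[lebesgue_rV R d]_x (g x * phi x).

(* An element of the Gaussian Sobolev space of dominating mixed smoothness
   alpha: its continuous representative bundled with its weak derivatives
   D^r f, |r|_oo <= alpha.  The latter are determined by f up to null sets, so
   the norm below depends on the function only.  The case r = 0 says that f
   itself is square integrable. *)
Record gauss_sobolev (alpha : nat) := GaussSobolev {
  sobolev_fun :> 'rV[R]_d -> R;
  sobolev_deriv : {ffun 'I_d -> 'I_alpha.+1} -> 'rV[R]_d -> R;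
  sobolev_continuous : continuous sobolev_fun;
  sobolev_deriv_L2 : forall r, gauss_L2 (sobolev_deriv r);
  sobolev_derivP : forall r : {ffun 'I_d -> 'I_alpha.+1},
    weak_derivative (fun i => r i) sobolev_fun (sobolev_deriv r) }.

Definition sobolev_norm alpha (F : gauss_sobolev alpha) : R :=
  Num.sqrt (\sum_r gauss_L2norm (sobolev_deriv F r) ^+ 2).

End gauss.

(* A list of pairs (w, x) stands for the functional \sum_i w_i delta_{x_i}. *)
Section quadrature.
Context {R : realType}.

Definition quad_app (X : Type) (q : seq (R * X)) (f : X -> R) : R :=
  \sum_(wx <- q) wx.1 * f wx.2.

(* probabilists' Hermite polynomials, He_(n+1) = X He_n - He_n' *)
Fixpoint hermite (n : nat) : {poly R} :=
  if n is m.+1 then 'X * hermite m - (hermite m)^`() else 1.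

Definition gauss_hermite_rule (n : nat) (q : seq (R * R)) : Prop :=
  [/\ size q = n, uniq (unzip2 q),
      forall x, (x \in unzip2 q) = root (hermite n) x &
      forall p : {poly R}, (size p <= n.*2)%N ->
        quad_app q (fun x => p.[x]) =
        \int[@lebesgue_measure R]_x (p.[x] * normal_pdf 0 1 x)].

Definition gauss_hermite_rules (n : nat -> nat) (Q : nat -> seq (R * R)) : Prop :=
  Q 0%N = [::] /\ forall l, (0 < l)%N -> gauss_hermite_rule (n l) (Q l).

Definition quad_opp (X : Type) (q : seq (R * X)) : seq (R * X) :=
  [seq (- wx.1, wx.2) | wx <- q].

Definition quad_diff (Q : nat -> seq (R * R)) (l : nat) : seq (R * R) :=
  if l is k.+1 then Q k.+1 ++ quad_opp (Q k) else [::].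

Definition quad_tensor (d : nat) (D : 'I_d -> seq (R * R)) :
    seq (R * 'rV[R]_d) :=
  [seq (\prod_j (tnth (in_tuple (D j)) (i j)).1,
        \row_j (tnth (in_tuple (D j)) (i j)).2)
  | i : {dffun forall j : 'I_d, 'I_(size (D j))}].

(* No cancellation takes place between the terms: every node of every
   Q_(l_j) and Q_(l_j - 1) occurring in the sum is kept. *)
Definition sparse_grid (d : nat) (Q : nat -> seq (R * R))
    (Lambda : {fset {ffun 'I_d -> nat}}) : seq (R * 'rV[R]_d) :=
  flatten [seq quad_tensor (fun j => quad_diff Q (l j))
          | l : {ffun 'I_d -> nat} <- enum_fset Lambda].

Definition num_evals (d : nat) (q : seq (R * 'rV[R]_d)) : nat :=
  size (undup (unzip2 q)).

End quadrature.

Definition axis_index (d : nat) (j : 'I_d) (l : nat) : {ffun 'I_d -> nat} :=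
  [ffun i => if i == j then l else 1%N].

Definition down_closed_one_direction (d : nat)
    (Lambda : {fset {ffun 'I_d -> nat}}) : Prop :=
  exists j : 'I_d, forall l : nat, axis_index j l \in Lambda ->
    forall k : nat, (1 <= k <= l)%N -> axis_index j k \in Lambda.

(* Main.v *)
Require Import Defs.
From HB Require Import structures.
From mathcomp Require Import all_boot all_order all_algebra finmap.
From mathcomp Require Import all_classical all_reals all_analysis.
From mathcomp Require Import measurable_realfun ring lra zify.
Set Implicit Arguments.
Unset Strict Implicit.
Unset Printing Implicit Defensive.
Import Order.TTheory GRing.Theory Num.Theory.
Import numFieldNormedType.Exports.
Local Open Scope classical_set_scope.
Local Open Scope ring_scope.

(** The lower bound already holds for functions of a single coordinate.

    Let [j] be the direction in which the index set is downward-closed.  On a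
    function [x |-> g (x 0 j)] the sparse grid reduces to a multiple of one
    univariate rule: every difference [Q_l - Q_(l-1)] with [1 < l] annihilates
    constants, so only the indices on the [j]-th axis contribute, and these form
    an initial segment [1, ..., L], so that the sum telescopes to [Q_L]
    ([sparse_grid_coord]).  The sparse grid uses at least as many points as [Q_L]
    ([num_evals_ge]).  The integral and the Sobolev norm reduce to their
    univariate counterparts as well ([gauss_int_coord],
    [coord_sobolev_norm_le]), because the Gaussian is a product measure and the
    weak derivatives in the other directions vanish ([integral_partials]).

    It remains to fool the Gauss-Hermite rule with [n] nodes
    ([fooling_function]).  Two nonnegative zeros of [He_n] are at distance at
    least [1 / sqrt n] ([hermite_root_gap]).  Hence the unit interval splits into
    about [sqrt n] cells each of which contains an interval of length of order
    [1 / sqrt n] free of nodes.  The sum of bumps of height [1] on these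
    intervals vanishes at all nodes, has an integral bounded below
    independently of [n], and its derivatives up to order [alpha] are at most a
    constant times [n ^ (alpha / 2)].  The ratio of the integral to the norm is
    therefore at least a constant times [n ^ (- alpha / 2)].  If the index set
    does not meet the axis, the sparse grid vanishes on all functions of the
    coordinate [j], and the function for [n = 1] can be used. *)

(** * Gaps between zeros of Hermite polynomials *)

Section hermite.
Context {R : realType}.

(** Hermite's equation.  The recursion turns it into [He_(n+1)' = (n+1) He_n],
    and this identity in turn gives the equation of the next degree. *)
Lemma hermite_ode (n : nat) :
  (hermite n : {poly R})^`()^`() = 'X * (hermite n)^`() - (hermite n) *+ n.
Proof.
elim: n => [|n IHn] /=; first by rewrite !derivC mulr0 subr0.
set H := hermite n in IHn *.
have dH : ('X * H - H^`())^`() = H *+ n.+1.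
  by rewrite derivB derivM derivX mul1r IHn mulrSr; ring.
by rewrite dH derivMn mulrnAr -mulrnBl; congr (_ *+ _); ring.
Qed.

Lemma size_hermite (n : nat) : size (hermite n : {poly R}) = n.+1.
Proof.
elim: n => [|n IHn] /=; first by rewrite size_poly1.
have h0 : (hermite n : {poly R}) != 0 by rewrite -size_poly_eq0 IHn.
have sX : size ('X * hermite n : {poly R}) = n.+2.
  by rewrite mulrC size_mulX // IHn.
rewrite size_polyDl// sX size_polyN.
by rewrite (ltn_trans (lt_size_deriv h0))// IHn.
Qed.

Lemma hermite_neq0 (n : nat) : (hermite n : {poly R}) != 0.
Proof. by rewrite -size_poly_eq0 size_hermite. Qed.

Lemma poly_nonzero_between (p : {poly R}) (a b : R) :
  p != 0 -> a < b -> exists2 x, x \in `]a, b[ & p.[x] != 0.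
Proof.
move=> p0 ab; apply: contrapT => noroot.
pose N := (size p).+1.
pose t (i : nat) : R := a + (b - a) * (i.+1%:R / N.+1%:R).
have N0 : 0 < N.+1%:R :> R by rewrite ltr0n.
have := @max_poly_roots _ p [seq t i | i <- iota 0 N] p0.
rewrite size_map size_iota ltnNge leqnSn => H; suff: false = true by [].
apply: H.
  apply/allP => y /mapP[i]; rewrite mem_iota add0n => /= iN ->.
  apply/rootP/eqP; apply: contrapT => /negP h; apply: noroot; exists (t i) => //.
  rewrite in_itv/=; apply/andP; split.
    by rewrite ltrDl mulr_gt0 ?subr_gt0// divr_gt0.
  rewrite -ltrBrDl -[ltRHS]mulr1 ltr_pM2l ?subr_gt0//.
  by rewrite ltr_pdivrMr// mul1r ltr_nat ltnS.
rewrite map_inj_uniq ?iota_uniq// => i j /addrI /mulfI.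
rewrite subr_eq0 gt_eqF// => /(_ isT) /divIf.
rewrite gt_eqF// => /(_ isT) /eqP; rewrite eqr_nat eqSS.
by move=> /eqP.
Qed.

(** A Sturm comparison with constant coefficients, done by mean values.  Let
    [|He_n|] be maximal on [[a, b]] at [x0], so that [He_n'(x0) = 0].
    Hermite's equation says [(He_n' w)' = - n He_n w] for [w x = expR (- x^2/2)].
    Two applications of the mean value theorem to the left of [x0], first to
    [He_n] and then to [He_n' w], give
    [|He_n(x0)| <= n |He_n(x0)| (x0 - a)^2].  Since [w] decreases on the
    nonnegative half-line, staying to the left of [x0] costs no constant. *)
Lemma hermite_root_gap (n : nat) (a b : R) :
  0 <= a -> a < b -> root (hermite n) a -> root (hermite n) b ->
  1 <= n%:R * (b - a) ^+ 2.
Proof.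
move=> a0 ab /rootP pa /rootP pb.
set p : {poly R} := hermite n in pa pb *.
have cp : continuous (fun x => `|p.[x]|).
  by move=> x; apply: continuous_comp; [exact: continuous_horner|exact: norm_continuous].
have [|x0 x0ab maxp] := @EVT_max R (fun x => `|p.[x]|) a b (ltW ab).
  exact: continuous_subspaceT.
have M0 : 0 < `|p.[x0]|.
  have [x xab px] := poly_nonzero_between (hermite_neq0 n) ab.
  have xab' : x \in `[a, b]%R by exact: subset_itv_oo_cc xab.
  by apply: (lt_le_trans _ (maxp x xab')); rewrite normr_gt0.
have ax0 : a < x0.
  move: x0ab; rewrite in_itv/= => /andP[]; rewrite le_eqVlt => /predU1P[ax|//].
  by move: M0; rewrite -ax pa normr0 !ltxx.
have x0b : x0 < b.
  move: x0ab; rewrite in_itv/= => /andP[_]; rewrite le_eqVlt => /predU1P[ax|//].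
  by move: M0; rewrite ax pb normr0 !ltxx.
have dp0 : p^`().[x0] = 0.
  have sq (x : R) : is_derive x (1 : R) (horner (p ^+ 2)) (p ^+ 2)^`().[x] by exact: is_derive_poly.
  have : is_derive x0 (1 : R) (horner (p ^+ 2)) 0.
    apply: (@derive1_at_max _ _ a b); first exact: ltW.
    - by move=> x _; have [] := sq x.
    - by rewrite in_itv/= ax0 x0b.
    - move=> t tab; rewrite !horner_exp -real_normK ?num_real//.
      rewrite -[leRHS]real_normK ?num_real// lerXn2r ?nnegrE//.
      exact/maxp/subset_itv_oo_cc.
  move=> [_ d0]; have [_] := sq x0; rewrite d0 => /esym.
  rewrite deriv_exp hornerMn hornerM expr1.
  move/eqP; rewrite mulrn_eq0/= mulf_eq0 => /orP[/eqP //|/eqP px0].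
  by move: M0; rewrite px0 normr0 ltxx.
have [|eta etaI pE] := @MVT R (horner p) (horner p^`()) a x0 ax0.
  exact/continuous_subspaceT/continuous_horner.
have [aeta etax0] : a < eta /\ eta < x0 by move: etaI; rewrite in_itv/= => /andP.
(* The Gaussian weight [e] puts Hermite's equation in divergence form. *)
pose e (x : R) := expR (- (x ^+ 2 / 2)).
have de (x : R) : is_derive x (1 : R) e (- x * e x).
  rewrite /e; apply: is_derive_eq; rewrite /GRing.scale /=.
  by field.
pose u (x : R) := p^`().[x] * e x.
have du (x : R) : is_derive x (1 : R) u (- n%:R * p.[x] * e x).
  apply: (@is_derive_eq _ _ _ (horner p^`() * e)).
  rewrite /GRing.scale/= hermite_ode hornerD hornerN hornerM hornerX hornerMn -mulr_natl -/p.
  by ring.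
have [|th thI uE] := @MVT R u _ eta x0 etax0 (fun x _ => du x).
  apply/continuous_subspaceT => x; apply/differentiable_continuous.
  by apply/derivable1_diffP; have [] := du x.
have [etath thx0] : eta < th /\ th < x0 by move: thI; rewrite in_itv/= => /andP.
have eth : e th <= e eta.
  rewrite ler_expR lerN2 ler_pM2r ?invr_gt0// lerXn2r ?nnegrE ?ltW//.
    exact: le_lt_trans a0 aeta.
  by rewrite (le_lt_trans a0)// (lt_trans aeta).
have dpeta : `|p^`().[eta]| <= n%:R * `|p.[x0]| * (x0 - eta).
  have ee : 0 < e eta by exact: expR_gt0.
  rewrite -(ler_pM2r ee) -[X in _ * X]gtr0_norm// -normrM.
  move: uE; rewrite {1}/u dp0 mul0r sub0r => /(congr1 Num.norm).
  rewrite normrN -/(u eta) => ->.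
  rewrite !normrM normrN (@gtr0_norm _ (e th)) ?expR_gt0// normr_nat.
  rewrite (@gtr0_norm _ (x0 - eta)) ?subr_gt0//.
  rewrite -[leRHS]mulrA [_ * e eta]mulrC mulrA ler_pM2r ?subr_gt0//.
  rewrite ler_pM//; first exact: expR_ge0.
  rewrite ler_wpM2l// maxp// in_itv/= (ltW (lt_trans aeta etath))/=.
  by rewrite ltW// (lt_trans thx0).
have Mle : `|p.[x0]| <= n%:R * `|p.[x0]| * (x0 - eta) * (x0 - a).
  rewrite {1}(_ : `|p.[x0]| = `|p^`().[eta]| * (x0 - a)).
    by rewrite ler_wpM2r// subr_ge0 ltW.
  by rewrite -[X in _ * X]gtr0_norm ?subr_gt0// -normrM -pE pa subr0.
rewrite -(ler_pM2r M0) mul1r (le_trans Mle)// -mulrA mulrAC.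
rewrite ler_wpM2r// ler_wpM2l// expr2.
by rewrite ler_pM ?subr_ge0 ?(ltW ax0) ?(ltW etax0)//; lra.
Qed.

End hermite.

(** * A compactly supported bump and its derivatives *)

Section bump.
Context {R : realType}.

Lemma continuous_pos_partX (e : nat) : continuous (fun y : R => Num.max 0 y ^+ e).
Proof.
move=> z; apply: (@continuous_comp R R R (fun y : R => Num.max 0 y) (fun y : R => y ^+ e)).
  apply: (@continuous_max _ _ (cst 0) id); first exact: cvg_cst.
  exact: cvg_id.
exact: exprn_continuous.
Qed.

(** At [0] the difference quotient of [max 0 y ^ (e+2)] is [max 0 y ^ (e+1)]
    itself, which is continuous: this is Caratheodory's criterion. *)
Lemma is_derive_pos_partX (e : nat) (x : R) :
  is_derive x (1 : R) (fun y => Num.max 0 y ^+ e.+2) (e.+2%:R * Num.max 0 x ^+ e.+1).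
Proof.
have [x0|x0|<-] := ltgtP 0 x.
- apply: (@near_eq_is_derive R R R (horner ('X^(e.+2) : {poly R}))).
    near=> y; rewrite hornerXn max_r// ltW//.
    by near: y; exact: lt_nbhsr.
  by apply: is_derive_eq; rewrite derivXn hornerMn hornerXn -mulr_natl.
- rewrite expr0n/= mulr0.
  apply: (@near_eq_is_derive R R R (cst (0 : R))).
    near=> y; rewrite max_l ?expr0n// ltW//.
    by near: y; exact: lt_nbhsl.
- rewrite expr0n/= mulr0; apply/is_derive1_caratheodory.
  exists (fun y => Num.max 0 y ^+ e.+1); split.
  + move=> z; rewrite maxxx expr0n/= !subr0 [LHS]exprSr.
    by case: (ltP 0 z) => // _; rewrite expr0n/= !mul0r.
  + exact: continuous_pos_partX.
  + by rewrite maxxx expr0n.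
Unshelve. all: by end_near. Qed.

Definition parabola : {poly R} := 'X * (1 - 'X).

(** With [W = X (1 - X)], the rule
    [(q max(0,W)^a)' = (q' W + a q W') max(0,W)^(a-1)] for [2 <= a] makes every
    derivative of [max(0,W)^e] of order [k < e] a polynomial times
    [max(0,W)^(e-k)]; this recursion computes that polynomial. *)
Fixpoint bump_coef (e k : nat) : {poly R} :=
  if k is k'.+1 then
    (bump_coef e k')^`() * parabola
    + (bump_coef e k' * parabola^`()) *+ (e - k')
  else 1.

(** The [k]-th derivative of a bump of class [C^(e-1)] supported on [[0, 1]]. *)
Definition bump (e k : nat) (t : R) : R :=
  (bump_coef e k).[t] * Num.max 0 parabola.[t] ^+ (e - k).

Lemma parabolaE (t : R) : parabola.[t] = t * (1 - t).
Proof. by rewrite /parabola hornerM hornerX hornerD hornerN hornerX hornerC. Qed.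

Lemma is_derive_bump (e k : nat) (t : R) : (k.+1 < e)%N ->
  is_derive t (1 : R) (bump e k) (bump e k.+1 t).
Proof.
move=> ke; rewrite /bump.
have -> : (e - k.+1 = (e - k.+2).+1)%N by lia.
have ek : (e - k = (e - k.+2).+2)%N by lia.
set a := (e - k.+2)%N in ek *.
pose P := fun y : R => Num.max 0 y ^+ a.+2.
have dP : is_derive t (1 : R) (P \o horner parabola) _ :=
  is_derive1_comp (is_derive_pos_partX a _) (is_derive_poly _ _).
rewrite ek; apply: (@is_derive_eq _ _ _ (horner (bump_coef e k) * (P \o horner parabola))).
rewrite /GRing.scale/= ek hornerD hornerMn (hornerM _ parabola) (hornerM _ parabola^`()).
rewrite -[_ *+ a.+2]mulr_natl /P /=.
have -> : Num.max 0 parabola.[t] ^+ a.+2 =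
    parabola.[t] * Num.max 0 parabola.[t] ^+ a.+1.
  by rewrite exprS; case: (ltP 0 parabola.[t]) => // _; rewrite expr0n/= !mulr0.
by ring.
Qed.

Lemma continuous_bump (e k : nat) : continuous (bump e k).
Proof.
move=> t; apply: continuousM; first exact: continuous_horner.
apply: (@continuous_comp R R R (horner parabola) (fun y => Num.max 0 y ^+ (e - k))).
  exact: continuous_horner.
exact: continuous_pos_partX.
Qed.

Lemma bump_support (e k : nat) (t : R) : (k < e)%N ->
  bump e k t != 0 -> 0 < t < 1.
Proof.
move=> ke; apply: contraNT => tI; rewrite /bump max_l.
  by rewrite expr0n subn_eq0 leqNgt ke mulr0.
rewrite parabolaE; move: tI; rewrite negb_and -!leNgt => /orP[t0|t1]; nra.
Qed.

Lemma bump_bounded (e k : nat) : (k < e)%N ->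
  exists B, forall t, `|bump e k t| <= B.
Proof.
move=> ke.
have [|c cI maxc] := @EVT_max R (fun x => `|bump e k x|) 0 1 ler01.
  apply: continuous_subspaceT => x; apply: continuous_comp.
    exact: continuous_bump.
  exact: norm_continuous.
exists `|bump e k c| => t; have [->|/(bump_support ke)/andP[t0 t1]] := eqVneq (bump e k t) 0.
  by rewrite normr0.
by apply: maxc; rewrite in_itv/= !ltW.
Qed.

Lemma bump0_ge0 (e : nat) (t : R) : 0 <= bump e 0 t.
Proof. by rewrite /bump/= hornerC mul1r exprn_ge0// le_max lexx. Qed.

Lemma bump0_ge (e : nat) (t : R) : 1 / 4 <= t <= 3 / 4 ->
  (3 / 16) ^+ e <= bump e 0 t.
Proof.
move=> /andP[t1 t3]; rewrite /bump/= hornerC mul1r subn0.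
have h : 3 / 16 <= Num.max 0 (parabola.[t] : R).
  by rewrite le_max parabolaE; apply/orP; right; nra.
by apply: lerXn2r => //; rewrite nnegrE; lra.
Qed.

End bump.

(** * Trains of bumps *)

(** The number of cells: a cell of length [1/m] is shorter than the minimal gap
    [1/sqrt n] between zeros of [He_n], while [m] stays of order [sqrt n]. *)
Lemma square_above (n : nat) : (0 < n)%N ->
  exists m, (n < m ^ 2 <= 4 * n)%N.
Proof.
elim: n => // -[_ _|n IHn _]; first by exists 2.
have [//|m /andP[nm mn]] := IHn.
have [lt|le] := ltnP n.+2 (m ^ 2); first by exists m; lia.
exists m.+1; rewrite -!mulnn in nm mn le *; nia.
Qed.

Section bump_train.
Context {R : realType}.
Variables (e M m : nat) (c : 'I_m -> nat).
Hypotheses (M_gt0 : (0 < M)%N) (c_inj : injective c).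

(** Bumps on the intervals [[c i / M, (c i + 1) / M]]; the factor [M ^+ k] is
    the effect of the rescaling on the [k]-th derivative. *)
Definition bump_train (k : nat) (x : R) : R :=
  M%:R ^+ k * \sum_(i < m) bump e k (M%:R * x - (c i)%:R).

Lemma is_derive_bump_train (k : nat) (x : R) : (k.+1 < e)%N ->
  is_derive x (1 : R) (bump_train k) (bump_train k.+1 x).
Proof.
move=> ke; pose a i := fun y : R => M%:R * y - (c i)%:R.
have da i : is_derive x (1 : R) (a i) M%:R.
  by apply: is_derive_eq; rewrite subr0 /GRing.scale/= mulr1.
have ds : is_derive x (1 : R) (\sum_(i < m) (bump e k \o a i))
    (\sum_(i < m) (bump e k.+1 (a i x) * M%:R)).
  by apply: is_derive_sum => j; apply: is_derive1_comp; exact: is_derive_bump.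
rewrite (_ : bump_train k = M%:R ^+ k \*o (\sum_(i < m) (bump e k \o a i))); last first.
  by apply/funext => y; rewrite /bump_train/= fct_sumE.
apply: is_derive_eq.
by rewrite /bump_train -mulr_suml exprSr -mulrA [_ * M%:R]mulrC.
Qed.

Lemma continuous_affine_bump (k : nat) (i : 'I_m) :
  continuous (fun x : R => bump e k (M%:R * x - (c i)%:R)).
Proof.
move=> x; apply: (@continuous_comp R R R (fun y => M%:R * y - (c i)%:R)).
  apply: (@cvgB _ R^o); last exact: cvg_cst.
  by apply: cvgM; [exact: cvg_cst|exact: cvg_id].
exact: continuous_bump.
Qed.

Lemma continuous_bump_train (k : nat) : continuous (bump_train k).
Proof.
move=> x; apply: cvgM; first exact: cvg_cst.
apply: cvg_big; first exact: add_continuous.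
by move=> i _; exact: continuous_affine_bump.
Qed.

Lemma bump_disjoint (k : nat) (x : R) (i j : 'I_m) : (k < e)%N ->
  bump e k (M%:R * x - (c i)%:R) != 0 -> bump e k (M%:R * x - (c j)%:R) != 0 ->
  i = j.
Proof.
move=> ke /(bump_support ke)/andP[i0 i1] /(bump_support ke)/andP[j0 j1].
apply: c_inj; apply/eqP; rewrite eqn_leq -[(c i <= _)%N]ltnS -[(c j <= _)%N]ltnS.
by rewrite -!(ltr_nat R) !mulrS; apply/andP; split; lra.
Qed.

(** The supports are disjoint, so the number of bumps does not enter the bound. *)
Lemma bump_train_bounded (k : nat) (B : R) : (k < e)%N -> 0 <= B ->
  (forall t, `|bump e k t| <= B) -> forall x, `|bump_train k x| <= M%:R ^+ k * B.
Proof.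
move=> ke B0 leB x; rewrite normrM normrX normr_nat ler_wpM2l ?exprn_ge0//.
have [i bi|b0] := pickP (fun i : 'I_m => bump e k (M%:R * x - (c i)%:R) != 0).
  rewrite (bigD1 i)//= big1 ?addr0// => j ji; apply/eqP.
  by apply: contraNT ji => bj; rewrite (bump_disjoint ke bj bi).
by rewrite big1 ?normr0// => i _; apply/eqP; rewrite -[_ == _]negbK b0.
Qed.

Lemma bump_train0_ge0 (x : R) : 0 <= bump_train 0 x.
Proof. by rewrite /bump_train mul1r sumr_ge0// => i _; exact: bump0_ge0. Qed.

(** On the middle half of its support a bump is at least [(3/16)^e], and the
    Gaussian density is at least its value at [1] throughout [[0, 1]]. *)
Lemma bump_train_integral : (forall i, (c i < M)%N) ->
  ((m%:R / M%:R * ((3 / 16) ^+ e * normal_pdf 0 1 (1 : R) / 2))%:E <=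
   \int[@lebesgue_measure R]_x (bump_train 0 x * normal_pdf 0 1 x)%:E)%E.
Proof.
move=> cM; have M0 : 0 < M%:R :> R by rewrite ltr0n.
pose h (i : 'I_m) (x : R) := bump e 0 (M%:R * x - (c i)%:R) * normal_pdf 0 1 x.
have h0 i x : 0 <= h i x by rewrite mulr_ge0 ?bump0_ge0 ?normal_pdf_ge0.
have mh i : measurable_fun setT (h i).
  apply: measurable_funM; last exact: measurable_normal_pdf.
  by apply: continuous_measurable_fun; exact: continuous_affine_bump.
have -> : (fun x : R => (bump_train 0 x * normal_pdf 0 1 x)%:E) =
    (fun x => \sum_(i < m) (h i x)%:E)%E.
  by apply/funext => x; rewrite /bump_train mul1r mulr_suml sumEFin.
rewrite ge0_integral_sum//; last 2 first.
- by move=> i; apply/measurable_EFinP; exact: mh.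
- by move=> i x _; rewrite lee_fin.
set K := (3 / 16) ^+ e * _.
have K0 : 0 <= K by rewrite mulr_ge0 ?normal_pdf_ge0// exprn_ge0.
have -> : m%:R / M%:R * (K / 2) = \sum_(i < m) (K * (2 * M%:R)^-1).
  by rewrite sumr_const card_ord -mulr_natl; field; rewrite ?gt_eqF.
rewrite -sumEFin; apply: lee_sum => i _.
pose l : R := ((c i)%:R + 1 / 4) / M%:R; pose r : R := ((c i)%:R + 3 / 4) / M%:R.
have l_lt_r : l < r by rewrite ltr_pM2r ?invr_gt0//; lra.
apply: (@le_trans _ _ (\int[@lebesgue_measure R]_(x in `[l, r]) (h i x)%:E)%E); last first.
  apply: ge0_subset_integral => //; first by apply/measurable_EFinP; exact: mh.
  by move=> x _; rewrite lee_fin.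
apply: (@le_trans _ _ (\int[@lebesgue_measure R]_(x in `[l, r]) (cst K%:E x))%E).
  rewrite integral_cst// [X in (_ * X)%E](_ : _ = (r - l)%:E); last first.
    by have := lebesgue_measure_itv `[l, r]; rewrite /= lte_fin l_lt_r -EFinB.
  rewrite -EFinM lee_fin.
  rewrite (_ : r - l = (2 * M%:R)^-1)// /l /r.
  by field; rewrite ?gt_eqF.
apply: ge0_le_integral => //.
- by apply/measurable_EFinP; apply: measurable_funS (mh i).
move=> x /=; rewrite in_itv/= => /andP[]; rewrite ler_pdivrMr// ler_pdivlMr// => lx xr.
rewrite lee_fin /h ler_pM ?normal_pdf_ge0 ?exprn_ge0//.
  by apply: bump0_ge; apply/andP; split; lra.
have c0 : 0 <= (c i)%:R :> R by [].
have c1 : (c i)%:R + 1 <= M%:R :> R by rewrite -(natrD _ _ 1) ler_nat addn1.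
rewrite !normal_pdfE// ler_wpM2l ?normal_peak_ge0// ler_expR !subr0.
rewrite ler_pM2r// lerN2 expr1n.
have x0 : 0 <= x by rewrite -(pmulr_lge0 _ M0); lra.
have x1 : x <= 1 by rewrite -(ler_pM2r M0); lra.
nra.
Qed.

End bump_train.

(** * Fooling the univariate Gauss-Hermite rule *)

(** A nonnegative [C^alpha] function that vanishes at the zeros of [He_n], has
    Gaussian integral bounded below, and derivatives of order [n^(alpha/2)].
    Cut [[0, 1]] into [m] cells with [n < m^2 <= 4n].  By [hermite_root_gap] a
    cell contains at most one zero, hence one of its open halves contains
    none; put a bump of width [1/(2m)] there. *)
Lemma fooling_function (R : realType) (alpha : nat) :
  exists c C : R, [/\ 0 < c, 0 < C & forall n, (0 < n)%N ->
    exists g : nat -> R -> R,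
    [/\ forall k x, (k < alpha)%N -> is_derive x (1 : R) (g k) (g k.+1 x),
        forall k, continuous (g k),
        forall x, root (hermite n) x -> g 0%N x = 0,
        forall x, 0 <= g 0%N x &
        (forall k x, (k <= alpha)%N -> `|g k x| <= C * Num.sqrt n%:R ^+ alpha) /\
        (c%:E <= \int[@lebesgue_measure R]_x (g 0%N x * normal_pdf 0 1 x)%:E)%E]].
Proof.
have /choice[B hB] : forall k, exists b : R, (k < alpha.+1)%N ->
    forall t, `|bump alpha.+1 k t| <= b.
  move=> k; have [ka|ka] := ltnP k alpha.+1; last by exists 0.
  by have [b hb] := @bump_bounded R _ _ ka; exists b.
pose Bmax := \sum_(k < alpha.+1) `|B k| + 1.
have Bmax0 : 0 < Bmax by rewrite ltr_wpDl// sumr_ge0.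
have leBmax k t : (k < alpha.+1)%N -> `|bump alpha.+1 k t| <= Bmax.
  move=> ka; rewrite (le_trans (hB k ka t))// (le_trans (ler_norm _))//.
  rewrite /Bmax (bigD1 (Ordinal ka))//= -addrA lerDl addr_ge0// sumr_ge0//.
exists ((3 / 16) ^+ alpha.+1 * normal_pdf 0 1 (1 : R) / 4), (4 ^+ alpha * Bmax).
split.
- rewrite !mulr_gt0// ?exprn_gt0// normal_pdfE//.
  by rewrite mulr_gt0 ?normal_peak_gt0// expR_gt0.
- by rewrite mulr_gt0// exprn_gt0.
move=> n n0; have [m /andP[nm mn]] := square_above n0.
have m0 : (0 < m)%N by case: m nm {mn} => //; rewrite exp0n.
have mR : 0 < m%:R :> R by rewrite ltr0n.
pose M := m.*2; have M0 : (0 < M)%N by rewrite double_gt0.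
have MR : M%:R = 2 * m%:R :> R by rewrite /M -mul2n natrM.
(* If the left half of the cell contains a zero, the bump goes to the right half. *)
pose rooted (i : 'I_m) := `[< exists y : R, root (hermite n) y /\
  i.*2%:R < M%:R * y < i.*2.+1%:R >].
pose c (i : 'I_m) : nat := (rooted i + i.*2)%N.
have cK : injective c.
  move=> i j /(congr1 half); rewrite /c !half_bit_double => ij; exact: val_inj.
have cM i : (c i < M)%N.
  have := ltn_ord i; rewrite /c /M => im; case: (rooted i); rewrite /= -!mul2n; lia.
exists (bump_train alpha.+1 M c); split.
- by move=> k x ka; exact: is_derive_bump_train.
- exact: continuous_bump_train.
- move=> x rx; rewrite /bump_train big1 ?mulr0// => i _; apply/eqP.
  apply/negPn/negP => /(bump_support (ltn0Sn _)) /andP[].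
  rewrite subr_gt0 ltrBlDr => ix xi.
  have : rooted i.
    move: ix xi; rewrite /c; case: (boolP (rooted i)) => // /asboolPn nr.
    rewrite add0n => ix xi; exfalso; apply: nr; exists x; split=> //.
    by rewrite ix mulrS.
  move=> ri; move: ix xi; rewrite /c ri; move: ri => /asboolP[y [ry /andP[iy yi]]].
  rewrite add1n => ix xi.
  have y0 : 0 <= y.
    have := le_lt_trans (ler0n R _) iy; rewrite pmulr_rgt0 ?ltr0n//; exact: ltW.
  have yx : y < x by rewrite -(ltr_pM2l (x := M%:R)) ?ltr0n// (lt_trans yi).
  have := hermite_root_gap y0 yx ry rx; apply/negP; rewrite -ltNge.
  have xy : m%:R * (x - y) < 1.
    rewrite -(ltr_pM2l (x := 2))// mulrA -MR mulrBr.
    by move: xi iy; rewrite -addn1 natrD; lra.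
  have xy0 : 0 < x - y by rewrite subr_gt0.
  apply: (@lt_trans _ _ ((m%:R * (x - y)) ^+ 2)).
    by rewrite exprMn ltr_pM2r ?exprn_gt0// -natrX ltr_nat.
  by rewrite expr_lt1// mulr_ge0// ltW.
- exact: bump_train0_ge0.
split.
  move=> k x ka; have := @bump_train_bounded R alpha.+1 M m c cK k Bmax ka (ltW Bmax0).
  move=> /(_ (leBmax k ^~ ka) x) /le_trans; apply.
  rewrite -mulrA [Bmax * _]mulrC mulrA ler_pM2r// -exprMn.
  apply: (@le_trans _ _ (M%:R ^+ alpha)).
    by rewrite ler_weXn2l// ler1n.
  rewrite lerXn2r ?nnegrE// ?mulr_ge0//.
  rewrite -[X in _ <= X * _](@ger0_norm _ 4)// -sqrtr_sqr -sqrtrM ?sqr_ge0//.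
  rewrite -[leLHS]ger0_norm// -sqrtr_sqr ler_wsqrtr//.
  rewrite -!natrX -natrM ler_nat /M -mul2n expnMn; lia.
apply: le_trans (bump_train_integral alpha.+1 M0 cM).
rewrite lee_fin MR le_eqVlt; apply/orP; left; apply/eqP; field.
by rewrite gt_eqF.
Qed.

(** * Fubini and the Gaussian measure on row vectors *)

Section fubini_rV.
Context {R : realType}.
Local Notation leb := (@lebesgue_measure R).

Lemma ge0_integral_rV_cons (n : nat) (f : 'rV[R]_n.+1 -> \bar R) :
  measurable_fun setT f -> (forall x, 0 <= f x)%E ->
  (\int[lebesgue_rV R n.+1]_x f x =
   \int[leb]_a \int[lebesgue_rV R n]_v f (rV_cons (a, v)))%E.
Proof.
move=> mf f0.
transitivity (\int[leb \x lebesgue_rV R n]_p (f \o @rV_cons R n) p)%E.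
  have := @ge0_integral_pushforward _ _ _ _ R _ (@measurable_rV_cons R n)
    (leb \x lebesgue_rV R n)%E setT f measurableT mf (fun y _ => f0 y).
  by rewrite preimage_setT => <-.
apply: fubini_tonelli1 => //=.
by apply: measurableT_comp => //; exact: measurable_rV_cons.
Qed.

Lemma integrable_rV_cons (n : nat) (f : 'rV[R]_n.+1 -> \bar R) :
  (lebesgue_rV R n.+1).-integrable setT f ->
  (leb \x lebesgue_rV R n)%E.-integrable setT (f \o @rV_cons R n).
Proof.
move=> /integrableP[mf intf]; apply/integrableP; split.
  by apply: measurableT_comp => //; exact: measurable_rV_cons.
apply: le_lt_trans intf; rewrite le_eqVlt; apply/orP; left; apply/eqP.
have := @ge0_integral_pushforward _ _ _ _ R _ (@measurable_rV_cons R n)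
  (leb \x lebesgue_rV R n)%E setT (abse \o f) measurableT.
rewrite preimage_setT => <-//.
  by apply: measurableT_comp.
by move=> y _; exact: abse_ge0.
Qed.

Lemma integral_rV_cons12 (n : nat) (f : 'rV[R]_n.+1 -> \bar R) :
  (lebesgue_rV R n.+1).-integrable setT f ->
  (\int[lebesgue_rV R n.+1]_x f x =
   \int[leb]_a \int[lebesgue_rV R n]_v f (rV_cons (a, v)))%E.
Proof.
move=> intf; have if' := integrable_rV_cons intf.
transitivity (\int[leb \x lebesgue_rV R n]_p (f \o @rV_cons R n) p)%E.
  have := @integral_pushforward _ _ _ _ R _ (@measurable_rV_cons R n)
    (leb \x lebesgue_rV R n)%E setT f.
  rewrite preimage_setT => <-//.
  exact: measurable_int intf.
by rewrite -integral12_prod_meas1.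
Qed.

Lemma integral_rV_cons21 (n : nat) (f : 'rV[R]_n.+1 -> \bar R) :
  (lebesgue_rV R n.+1).-integrable setT f ->
  (\int[lebesgue_rV R n.+1]_x f x =
   \int[lebesgue_rV R n]_v \int[leb]_a f (rV_cons (a, v)))%E.
Proof.
move=> intf; rewrite integral_rV_cons12//.
exact: (Fubini (integrable_rV_cons intf)).
Qed.

End fubini_rV.

Section gauss_measure.
Context {R : realType}.
Local Notation leb := (@lebesgue_measure R).

Lemma eucl_norm_sqr (n : nat) (x : 'rV[R]_n) : eucl_norm x ^+ 2 = \sum_i x 0 i ^+ 2.
Proof. by rewrite sqr_sqrtr// sumr_ge0// => i _; exact: sqr_ge0. Qed.

Lemma gauss_rho_gt0 (n : nat) (x : 'rV[R]_n) : 0 < gauss_rho x.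
Proof. by rewrite mulr_gt0 ?expR_gt0// powR_gt0// mulr_gt0// pi_gt0. Qed.

Lemma gauss_rho_ge0 (n : nat) (x : 'rV[R]_n) : 0 <= gauss_rho x.
Proof. exact/ltW/gauss_rho_gt0. Qed.

Lemma measurable_gauss_rho (n : nat) : measurable_fun setT (@gauss_rho R n).
Proof.
rewrite /gauss_rho; under eq_fun do rewrite eucl_norm_sqr.
apply: measurable_funM => //; apply: measurableT_comp => //.
apply: measurableT_comp => //; apply: measurable_funM => //.
apply: measurable_sum => i; apply: measurable_funX.
exact: measurable_rV_coord.
Qed.

(** The density of the standard Gaussian is a product of univariate densities. *)
Lemma gauss_rho_cons (n : nat) (a : R) (v : 'rV[R]_n) :
  gauss_rho (rV_cons (a, v)) = normal_pdf 0 1 a * gauss_rho v.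
Proof.
rewrite /gauss_rho !eucl_norm_sqr big_ord_recl rV_cons0/=.
under eq_bigr do rewrite rV_consS/=.
rewrite normal_pdfE// /normal_peak /normal_fun subr0 expr1n mul1r.
set s := \sum_(i < n) _.
rewrite [(a ^+ 2 + s) / 2]mulrDl [- (_ / _ + _)]opprD expRD mulrACA.
congr (_ * (_ * _)); last by rewrite mulNr.
have -> : - (n.+1%:R / 2) = - 2^-1 + - (n%:R / 2) :> R by rewrite mulrS; field.
rewrite -[pi *+ 2]mulr_natl powRD; last first.
  by apply/implyP => _; rewrite gt_eqF// mulr_gt0// pi_gt0.
by rewrite powRN powR12_sqrt// mulr_ge0// pi_ge0.
Qed.

Lemma gauss_rho0 (x : 'rV[R]_0) : gauss_rho x = 1.
Proof. by rewrite /gauss_rho eucl_norm_sqr big_ord0 !mul0r oppr0 powRr0 expR0 mulr1. Qed.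

Lemma integral_gauss_rho (n : nat) :
  (\int[lebesgue_rV R n]_x (gauss_rho x)%:E = 1)%E.
Proof.
elim: n => [|n IHn].
  under eq_integral do rewrite gauss_rho0.
  rewrite /= integral_dirac// diracT mul1e//.
rewrite ge0_integral_rV_cons; last 2 first.
- by apply/measurable_EFinP; exact: measurable_gauss_rho.
- by move=> x; rewrite lee_fin gauss_rho_ge0.
under eq_integral => a _.
  under eq_integral do rewrite gauss_rho_cons EFinM.
  rewrite ge0_integralZl_EFin ?normal_pdf_ge0//; last 2 first.
  - by move=> x _; rewrite lee_fin gauss_rho_ge0.
  - by apply/measurable_EFinP; exact: measurable_gauss_rho.
  rewrite IHn mule1; over.
exact: integral_normal_pdf.
Qed.

(** The marginals of the standard Gaussian are standard normal. *)
Lemma integral_gauss_rho_coord (n : nat) (j : 'I_n) (h : R -> R) :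
  measurable_fun setT h -> (forall t, 0 <= h t) ->
  (\int[lebesgue_rV R n]_x (h (x 0 j) * gauss_rho x)%:E =
   \int[leb]_t (h t * normal_pdf 0 1 t)%:E)%E.
Proof.
move=> mh h0; elim: n j => [[]//|n IHn] j.
rewrite ge0_integral_rV_cons; last 2 first.
- apply/measurable_EFinP; apply: measurable_funM; last exact: measurable_gauss_rho.
  exact: measurableT_comp mh (measurable_rV_coord j).
- by move=> x; rewrite lee_fin mulr_ge0 ?gauss_rho_ge0.
case: (unliftP ord0 j) => [i ->|->].
  under eq_integral => a _.
    under eq_integral do rewrite gauss_rho_cons rV_consS/= mulrCA EFinM.
    rewrite ge0_integralZl_EFin ?normal_pdf_ge0//; last 2 first.
    - by move=> x _; rewrite lee_fin mulr_ge0 ?gauss_rho_ge0.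
    - apply/measurable_EFinP; apply: measurable_funM; last exact: measurable_gauss_rho.
      exact: measurableT_comp mh (measurable_rV_coord i).
    rewrite IHn; over.
  rewrite ge0_integralZr//=; last 3 first.
  - by apply/measurable_EFinP; exact: measurable_normal_pdf.
  - by move=> x _; rewrite lee_fin normal_pdf_ge0.
  - by apply: integral_ge0 => x _; rewrite lee_fin mulr_ge0 ?normal_pdf_ge0.
  by rewrite integral_normal_pdf mul1e.
apply: eq_integral => a _.
under eq_integral do rewrite gauss_rho_cons rV_cons0/= mulrA EFinM.
rewrite ge0_integralZl_EFin ?mulr_ge0 ?normal_pdf_ge0//; last 2 first.
- by move=> x _; rewrite lee_fin gauss_rho_ge0.
- by apply/measurable_EFinP; exact: measurable_gauss_rho.
by rewrite integral_gauss_rho mule1.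
Qed.

End gauss_measure.

(** * Continuous functions on row vectors *)

Section continuous_rV.
Context {R : realType}.

(** The coordinate sigma-algebra contains the open sets because an open set is a
    countable union of boxes with rational centres and radii [1/(k+1)]. *)
Lemma open_measurable_rV (n : nat) (A : set 'rV[R]_n) : open A -> measurable A.
Proof.
move=> oA.
pose box (p : 'rV[rat]_n * nat) : set 'rV[R]_n :=
  [set y | forall i, `|y 0 i - ratr (p.1 0 i)| < p.2.+1%:R^-1].
have mbox p : measurable (box p).
  have -> : box p = \bigcap_(i in [set: 'I_n])
      ((fun x : 'rV[R]_n => x 0 i) @^-1` ball (ratr (p.1 0 i) : R) p.2.+1%:R^-1).
    apply/seteqP; split=> y /= yp i.
      by move=> _; rewrite /ball/= distrC; exact: yp.
    by have := yp i I; rewrite /ball/= distrC.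
  apply: fin_bigcap_measurable => // i _; rewrite -[X in measurable X]setTI.
  by apply: measurable_rV_coord => //; exact: measurable_ball.
have -> : A = \bigcup_p (if `[< box p `<=` A >] then box p else set0).
  apply/seteqP; split=> [x Ax|x [p _]]; last by case: asboolP => // + xp; exact.
  have /nbhs_ballP[e /= e0 eA] := oA x Ax.
  pose k := Num.truncn (2 / e).
  have ke : k.+1%:R^-1 < e / 2.
    by rewrite invf_plt ?posrE ?divr_gt0// invf_div; exact: truncnS_gt.
  have : 0 < k.+1%:R^-1 :> R by rewrite invr_gt0.
  set dk := k.+1%:R^-1 in ke * => k0.
  have /choice[q qx] : forall i : 'I_n, exists q : rat, `|x 0 i - ratr q| < dk.
    move=> i; have : x 0 i - dk < x 0 i + dk by lra.
    move=> /rat_in_itvoo[q]; rewrite in_itv/= => /andP[q1 q2]; exists q.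
    by rewrite ltr_norml; apply/andP; split; lra.
  exists (\row_i q i, k) => //.
  case: asboolP => [_ i/=|/= bA]; first by rewrite mxE.
  exfalso; apply: bA => y /= yq; apply: eA; split => // i j; rewrite ord1.
  have := yq j; rewrite mxE -/dk => yj; have xj := qx j.
  have := ler_distD (ratr (q j)) (x 0 j) (y 0 j).
  rewrite /ball/= (distrC (ratr _)); lra.
apply: countable_bigcupT_measurable => [|p]; first exact: countableP.
by case: ifP.
Qed.

Lemma continuous_measurable_rV (n : nat) (f : 'rV[R]_n -> R) :
  continuous f -> measurable_fun setT f.
Proof.
move=> /continuousP cf; apply: (measurability _ (RGenOpens.measurableE R)).
move=> _ [_ [a [b ->] <-]]; rewrite setTI; apply: open_measurable_rV.
exact/cf/interval_open.
Qed.

Lemma continuous_rowP (T : topologicalType) (n : nat) (F : T -> 'rV[R]_n) :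
  (forall i, continuous (fun t => F t 0 i)) -> continuous F.
Proof.
move=> cF t; apply/cvg_ballP => e e0.
have : \forall u \near t, forall j, ball (F t 0 j) e (F u 0 j).
  by apply: filter_forall => j; have /cvg_ballP := cF j t; exact.
by apply: filterS => u Fu; split=> // i j; rewrite ord1.
Qed.

Lemma continuous_rV_cons_r (n : nat) (a : R) :
  continuous (fun v : 'rV[R]_n => rV_cons (a, v)).
Proof.
apply: continuous_rowP => i; case: (unliftP ord0 i) => [j|] ->.
  by under eq_fun do rewrite rV_consS; exact: coord_continuous.
by under eq_fun do rewrite rV_cons0; exact: cst_continuous.
Qed.

Lemma continuous_rV_cons_l (n : nat) (v : 'rV[R]_n) :
  continuous (fun a : R => rV_cons (a, v)).
Proof.
apply: continuous_rowP => i; case: (unliftP ord0 i) => [j|] ->.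
  by under eq_fun do rewrite rV_consS; exact: cst_continuous.
by under eq_fun do rewrite rV_cons0; move=> ? /=; exact: cvg_id.
Qed.

Lemma rV_cons_addl (n : nat) (a h : R) (v : 'rV[R]_n) :
  rV_cons (h + a, v) = h *: delta_mx 0 ord0 + rV_cons (a, v).
Proof.
apply/rowP => i; rewrite [RHS]mxE [in RHS]mxE [in RHS]mxE; case: (unliftP ord0 i) => [j|] ->.
  by rewrite !rV_consS eq_sym (negbTE (neq_lift _ _)) andbF mulr0 add0r.
by rewrite !rV_cons0/= mulr1.
Qed.

Lemma rV_cons_addr (n : nat) (a h : R) (v : 'rV[R]_n) (j : 'I_n) :
  rV_cons (a, h *: delta_mx 0 j + v) =
  h *: delta_mx 0 (lift ord0 j) + rV_cons (a, v).
Proof.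
apply/rowP => i; rewrite [RHS]mxE [in RHS]mxE [in RHS]mxE.
case: (unliftP ord0 i) => [k|] ->.
  by rewrite !rV_consS /= !mxE/= (inj_eq lift_inj).
by rewrite !rV_cons0 (negbTE (neq_lift _ _)) andbF mulr0 add0r.
Qed.

(** A directional derivative depends only on the restriction of the function to
    a line.  This transfers derivatives between the real line, a slice of the
    space, and the whole space. *)
Lemma is_derive_line (V W : normedModType R) (f : V -> R) (g : W -> R)
    (x v : V) (y w : W) (d : R) :
  (forall h : R, f (h *: v + x) = g (h *: w + y)) ->
  is_derive x v f d -> is_derive y w g d.
Proof.
move=> fg; have fg0 : f x = g y by have := fg 0; rewrite !scale0r !add0r.
have E : (fun h => h^-1 *: ((f \o shift x) (h *: v) - f x)) =
         (fun h => h^-1 *: ((g \o shift y) (h *: w) - g y)).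
  by apply/funext => h /=; rewrite fg fg0.
by move=> [cf df]; split; rewrite /derivable /derive -E.
Qed.

Definition vanishes_off_box (n : nat) (K : R) (f : 'rV[R]_n -> R) :=
  forall x : 'rV[R]_n, (exists i, K < `|x 0 i|) -> f x = 0.

(** A bounded function supported in a box is dominated by a multiple of the
    Gaussian density, which has integral [1]. *)
Lemma integrable_box (n : nat) (K : R) (f : 'rV[R]_n -> R) :
  continuous f -> vanishes_off_box K f ->
  (lebesgue_rV R n).-integrable setT (EFin \o f).
Proof.
move=> cf f0; pose L := `|K|.
pose A := [set v : 'rV[R]_n | forall i, `[- L, L]%classic (v ord0 i)].
have cA : compact A := rV_compact (fun=> @segment_compact R (- L) L).
have A0 : A !=set0.
  by exists 0 => i /=; rewrite mxE in_itv/= oppr_le0 normr_ge0.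
have cnf : {within A, continuous (fun x => `|f x|)}.
  apply: continuous_subspaceT => x; apply: continuous_comp; first exact: cf.
  exact: norm_continuous.
have [c _ maxc] := EVT_max_rV A0 cA cnf.
pose r : R := (2 * pi) `^ (- (n%:R / 2)) * expR (- ((\sum_(i < n) L ^+ 2) / 2)).
have r0 : 0 < r by rewrite mulr_gt0 ?expR_gt0// powR_gt0// mulr_gt0// pi_gt0.
pose C := `|f c| / r.
have C0 : 0 <= C by rewrite divr_ge0// ltW.
apply: (@le_integrable _ _ _ _ _ measurableT _ (fun x => C%:E * (gauss_rho x)%:E)%E).
- by apply/measurable_EFinP; exact: continuous_measurable_rV.
- move=> x _; rewrite -EFinM /= lee_fin [leRHS]ger0_norm; last first.
    by rewrite mulr_ge0// gauss_rho_ge0.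
  have [xA|xA] := pselect (A x); last first.
    rewrite f0 ?normr0; first by apply: mulr_ge0 => //; exact: gauss_rho_ge0.
    apply: contrapT => nK; apply: xA => i /=.
    rewrite in_itv/= -ler_norml leNgt; apply/negP => Ki; apply: nK; exists i.
    exact: le_lt_trans (ler_norm _) Ki.
  rewrite (le_trans (maxc x _)) ?inE// /C -mulrA ler_peMr//.
  rewrite mulrC ler_pdivlMr// mul1r /r /gauss_rho ler_wpM2l ?powR_ge0//.
  rewrite ler_expR lerN2 ler_pM2r// eucl_norm_sqr ler_sum// => i _.
  have := xA i; rewrite /= in_itv/= -ler_norml => xi.
  by rewrite -[x 0 i ^+ 2]real_normK ?num_real// lerXn2r ?nnegrE ?normr_ge0//.
- apply: integrableZl => //; apply/integrableP; split.
    by apply/measurable_EFinP; exact: measurable_gauss_rho.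
  under eq_integral do rewrite gee0_abs ?lee_fin ?gauss_rho_ge0//.
  by rewrite integral_gauss_rho ltry.
Qed.

End continuous_rV.

(** * Integration by parts against test functions *)

Section by_parts.
Context {R : realType}.
Local Notation leb := (@lebesgue_measure R).

Lemma integral_derivative_line (u du : R -> R) (K : R) :
  (forall t, is_derive t (1 : R) u (du t)) -> continuous du ->
  (forall t, K < `|t| -> u t = 0) -> (forall t, K < `|t| -> du t = 0) ->
  (\int[leb]_t (du t)%:E = 0)%E.
Proof.
move=> dudu cdu u0 du0; pose L : R := `|K| + 1.
have L0 : 0 < L by rewrite ltr_wpDl.
have KL : K < L by rewrite (le_lt_trans (ler_norm K))// ltrDl.
have cu : continuous u.
  by move=> t; apply/differentiable_continuous/derivable1_diffP; have [] := dudu t.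
transitivity (\int[leb]_(t in `[(- L)%R, L%R]) (du t)%:E)%E.
  rewrite [RHS]integral_mkcond; congr (integral _ _ _); apply/funext => t.
  rewrite patchE; case: ifPn => // /negP; rewrite inE/= in_itv/= -ler_norml => tL.
  by rewrite du0// (lt_trans KL)// ltNge; apply/negP.
rewrite (@continuous_FTC2 _ du u).
- by rewrite !u0 ?subee// ?normrN ger0_norm// ltW.
- by rewrite gtrN.
- exact: continuous_subspaceT.
- split.
  + by move=> t _; have [] := dudu t.
  + by apply: cvg_at_right_filter; exact: cu.
  + by apply: cvg_at_left_filter; exact: cu.
- by move=> t _; rewrite derive1E; exact: derive_val.
Qed.

(** By Fubini only the integral along direction [i] matters, and there the
    fundamental theorem of calculus gives the difference of two boundary
    values outside the box. *)
Lemma integral_partial_derivative (n : nat) (i : 'I_n) (f df : 'rV[R]_n -> R) (K : R) :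
  continuous f -> continuous df ->
  (forall x, is_derive x (delta_mx 0 i) f (df x)) ->
  vanishes_off_box K f -> vanishes_off_box K df ->
  (\int[lebesgue_rV R n]_x (df x)%:E = 0)%E.
Proof.
elim: n i f df => [[]//|n IHn] i f df cf cdf dfdf f0 df0.
have idf := integrable_box cdf df0.
case: (unliftP ord0 i) dfdf => [j|] ->{i} dfdf.
  rewrite integral_rV_cons12//; apply: integral0_eq => a _.
  apply: (IHn j (fun v => f (rV_cons (a, v)))).
  - by move=> v; apply: (@continuous_comp _ _ _ (fun v => rV_cons (a, v)) f);
      [exact: continuous_rV_cons_r|exact: cf].
  - by move=> v; apply: (@continuous_comp _ _ _ (fun v => rV_cons (a, v)) df);
      [exact: continuous_rV_cons_r|exact: cdf].
  - move=> v; apply: is_derive_line (dfdf _) => h.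
    by rewrite rV_cons_addr.
  - by move=> v [k Kk]; apply: f0; exists (lift ord0 k); rewrite rV_consS.
  - by move=> v [k Kk]; apply: df0; exists (lift ord0 k); rewrite rV_consS.
rewrite integral_rV_cons21//; apply: integral0_eq => v _.
apply: (@integral_derivative_line (fun a => f (rV_cons (a, v)))
          (fun a => df (rV_cons (a, v))) K).
- move=> a; apply: is_derive_line (dfdf _) => h.
  by rewrite -rV_cons_addl [h *: 1]mulr1.
- by move=> a; apply: (@continuous_comp _ _ _ (fun a : R => rV_cons (a, v)) df);
    [exact: continuous_rV_cons_l|exact: cdf].
- by move=> a Ka; apply: f0; exists ord0; rewrite rV_cons0.
- by move=> a Ka; apply: df0; exists ord0; rewrite rV_cons0.
Qed.

Lemma integral_by_parts (n : nat) (i : 'I_n) (f df psi dpsi : 'rV[R]_n -> R) (K : R) :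
  continuous f -> continuous df -> (forall x, is_derive x (delta_mx 0 i) f (df x)) ->
  continuous psi -> continuous dpsi ->
  (forall x, is_derive x (delta_mx 0 i) psi (dpsi x)) ->
  vanishes_off_box K psi -> vanishes_off_box K dpsi ->
  \int[lebesgue_rV R n]_x (f x * dpsi x) = - \int[lebesgue_rV R n]_x (df x * psi x).
Proof.
move=> cf cdf dfdf cpsi cdpsi dpsidpsi psi0 dpsi0.
have cM (g h : 'rV[R]_n -> R) : continuous g -> continuous h ->
    continuous (fun x : 'rV[R]_n => g x * h x).
  move=> cg ch x; exact: (cvgM (cg x) (ch x)).
have vM (g h : 'rV[R]_n -> R) : vanishes_off_box K h ->
    vanishes_off_box K (fun x : 'rV[R]_n => g x * h x).
  by move=> h0 x Kx; rewrite h0// mulr0.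
have i1 := integrable_box (cM _ _ cf cdpsi) (vM _ _ dpsi0).
have i2 := integrable_box (cM _ _ cdf cpsi) (vM _ _ psi0).
apply/eqP; rewrite -subr_eq0 opprK -RintegralD//.
rewrite /Rintegral.
suff -> : (\int[lebesgue_rV R n]_x (f x * dpsi x + df x * psi x)%:E = 0)%E by [].
apply: (@integral_partial_derivative _ i (fun x => f x * psi x) _ K).
- exact: cM.
- by move=> x; exact: (cvgD (cM _ _ cf cdpsi x) (cM _ _ cdf cpsi x)).
- move=> x; apply: (@is_derive_eq _ _ _ (f * psi)).
  by rewrite /GRing.scale/= [psi x * _]mulrC.
- exact: vM.
- by move=> x Kx; rewrite psi0// dpsi0// !mulr0 addr0.
Qed.

Lemma derive_locally_zero (n : nat) (U : set 'rV[R]_n) (v : 'rV[R]_n)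
    (f : 'rV[R]_n -> R) : open U ->
  (forall x, U x -> f x = 0) -> forall x, U x -> 'D_v f x = 0.
Proof.
move=> oU f0 x Ux; rewrite (near_eq_derive (g := cst 0)) ?derive_cst//.
by apply: filterS (open_nbhs_nbhs (conj oU Ux)) => y; exact: f0.
Qed.

Lemma test_function_box (n : nat) (phi : 'rV[R]_n -> R) : test_function phi ->
  exists K, forall s, vanishes_off_box K (partials s phi).
Proof.
move=> [_ _ csupp]; pose S := closure [set x | phi x != 0].
have [K [_ SK]] := compact_bounded csupp.
exists (K + 1) => s x [i Kx].
have oU : open (~` S) by exact/closed_openC/closed_closure.
have phi0 y : (~` S) y -> phi y = 0.
  by move=> nSy; apply/eqP/negPn/negP => py; apply: nSy; exact: subset_closure.
have partials0 : forall y, (~` S) y -> partials s phi y = 0.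
  by elim: s => //= j s IHs; exact: derive_locally_zero.
apply: partials0 => Sx; have := SK (K + 1) _ x Sx; rewrite ltrDl ltr01 => /(_ isT).
move=> xK; move: Kx; apply/negP; rewrite -leNgt (le_trans _ xK)//.
rewrite [leRHS]mx_normrE.
exact: (le_bigmax _ (fun ij : 'I_1 * 'I_n => `|x ij.1 ij.2|) (0, i)).
Qed.

Section coordinate_function.
Variables (n : nat) (j : 'I_n) (alpha : nat) (g : nat -> R -> R).
Hypothesis dg : forall k t, (k < alpha)%N -> is_derive t (1 : R) (g k) (g k.+1 t).
Hypothesis cg : forall k, continuous (g k).

Lemma continuous_coord (k : nat) : continuous (fun x : 'rV[R]_n => g k (x 0 j)).
Proof.
move=> x; apply: (@continuous_comp _ _ _ (fun x : 'rV[R]_n => x 0 j) (g k)).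
  exact: coord_continuous.
exact: cg.
Qed.

(** Partial integration moves the derivatives of [phi] one by one onto a
    function of the coordinate [j]; any derivative in another direction kills
    it.  Only the number of derivatives in direction [j] is limited by the
    smoothness [alpha]. *)
Lemma integral_partials (phi : 'rV[R]_n -> R) (s : seq 'I_n) (k : nat) :
  test_function phi -> (k + count (pred1 j) s <= alpha)%N ->
  \int[lebesgue_rV R n]_x (g k (x 0 j) * partials s phi x) =
  (-1) ^+ size s * \int[lebesgue_rV R n]_x
    ((if all (pred1 j) s then g (k + size s) (x 0 j) else 0) * phi x).
Proof.
move=> tphi; have [K phi0] := test_function_box tphi.
have [dphi cphi _] := tphi.
elim: s k => [|i s IHs] k /=; first by rewrite expr0 mul1r addn0.
move=> ka.
have dps x : is_derive x (delta_mx 0 i) (partials s phi) (partials (i :: s) phi x).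
  by apply: DeriveDef.
have byp (df : 'rV[R]_n -> R) : continuous df ->
    (forall x, is_derive x (delta_mx 0 i) (fun x => g k (x 0 j)) (df x)) ->
    \int[lebesgue_rV R n]_x (g k (x 0 j) * partials (i :: s) phi x) =
    - \int[lebesgue_rV R n]_x (df x * partials s phi x).
  move=> cdf dfdf.
  exact: (integral_by_parts (@continuous_coord k) cdf dfdf (cphi s) (cphi (i :: s))
    dps (phi0 s) (phi0 (i :: s))).
case: (eqVneq i j) ka byp => [->{i dps}|ij] ka byp; rewrite /= ?add1n ?add0n in ka *.
  have dfdf (x : 'rV[R]_n) : is_derive x (delta_mx 0 j : 'rV[R]_n)
      (fun x : 'rV[R]_n => g k (x 0 j)) (g k.+1 (x 0 j)).
    apply: is_derive_line (dg (x 0 j) _) => [h|]; last first.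
      by rewrite (leq_trans _ ka)// addnS ltnS leq_addr.
    by rewrite !mxE !eqxx.
  rewrite (byp _ (@continuous_coord k.+1) dfdf) IHs; last by rewrite addSnnS.
  by rewrite addSnnS exprS mulN1r mulNr.
have dfdf (x : 'rV[R]_n) : is_derive x (delta_mx 0 i : 'rV[R]_n)
    (fun x : 'rV[R]_n => g k (x 0 j)) (0 : R).
  apply: is_derive_line (is_derive_cst (g k (x 0 j)) x (delta_mx 0 i)) => h.
  by rewrite !mxE eq_sym (negbTE ij) andbF mulr0 add0r.
rewrite (byp _ (@cst_continuous _ _ 0) dfdf).
have zero (h : 'rV[R]_n -> R) : \int[lebesgue_rV R n]_x (0 * h x) = 0.
  rewrite /Rintegral; under eq_integral do rewrite mul0r.
  by rewrite integral0.
by rewrite !zero mulr0 oppr0.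
Qed.

End coordinate_function.

End by_parts.

(** * Sparse grids applied to functions of one coordinate *)

(** Distributivity for factors whose index types vary with the factor. *)
Lemma bigA_distr_dffun (R : comPzSemiRingType) (I : finType) (T_ : I -> finType)
    (P_ : forall i, T_ i -> R) :
  \prod_i \sum_(t : T_ i) P_ i t =
  \sum_(f : {dffun forall i, T_ i}) \prod_i P_ i (f i).
Proof.
pose Q_ i := [ffun t : T_ i => P_ i t].
transitivity (\prod_i \sum_(t : T_ i) Q_ i t).
  by apply: eq_bigr => i _; apply: eq_bigr => t _; rewrite ffunE.
transitivity (\prod_i \sum_(t in tagged_with T_ i) untag 0 (Q_ i) t).
  by apply: eq_bigr => i _; exact: (big_tag (fun i => Q_ i) i).
rewrite bigA_distr_big_dep -big_fprod.
rewrite (reindex (@fprod_of_dffun _ _)); last exact/onW_bij/fprod_of_dffun_bij.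
apply: eq_bigr => f _; apply: eq_bigr => i _; rewrite ffunE.
by rewrite /fprod_of_dffun fprodE.
Qed.

Section quadrature_theory.
Context {R : realType}.

Lemma quad_app_cat (X : Type) (q q' : seq (R * X)) f :
  quad_app (q ++ q') f = quad_app q f + quad_app q' f.
Proof. by rewrite /quad_app big_cat. Qed.

Lemma quad_app_opp (X : Type) (q : seq (R * X)) f :
  quad_app (quad_opp q) f = - quad_app q f.
Proof.
by rewrite /quad_app big_map -sumrN; apply: eq_bigr => wx _; rewrite mulNr.
Qed.

Lemma quad_app_nil (X : Type) (f : X -> R) : quad_app [::] f = 0.
Proof. by rewrite /quad_app big_nil. Qed.

Lemma quad_diffS (Q : nat -> seq (R * R)) (k : nat) f :
  quad_app (quad_diff Q k.+1) f = quad_app (Q k.+1) f - quad_app (Q k) f.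
Proof. by rewrite quad_app_cat quad_app_opp. Qed.

Lemma quad_tensor_prod (d : nat) (D : 'I_d -> seq (R * R)) (h : 'I_d -> R -> R) :
  quad_app (quad_tensor D) (fun x => \prod_i h i (x 0 i)) =
  \prod_i quad_app (D i) (h i).
Proof.
under [RHS]eq_bigr do rewrite /quad_app big_tnth.
rewrite bigA_distr_dffun /quad_app big_image/=.
apply: eq_bigr => f _; rewrite -big_split/=; apply: eq_bigr => i _.
by rewrite mxE.
Qed.

Lemma mem_quad_tensor (d : nat) (D : 'I_d -> seq (R * R)) (x : 'rV[R]_d) :
  (forall i, x 0 i \in unzip2 (D i)) -> x \in unzip2 (quad_tensor D).
Proof.
move=> xD.
have ltk i : (index (x 0%R i) (unzip2 (D i)) < size (D i))%N.
  by rewrite -(size_map snd) index_mem.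
pose f : {dffun forall i : 'I_d, 'I_(size (D i))} := [ffun i => Ordinal (ltk i)].
apply/mapP; exists (\prod_j (tnth (in_tuple (D j)) (f j)).1,
        \row_j (tnth (in_tuple (D j)) (f j)).2) => /=.
  by rewrite /quad_tensor /image_mem; apply/mapP; exists f; rewrite ?mem_enum.
apply/rowP => i; rewrite mxE ffunE (tnth_nth (0, 0))/=.
by rewrite -(nth_map _ 0) ?ltk// nth_index.
Qed.

Variables (n : nat -> nat) (Q : nat -> seq (R * R)).
Hypothesis n_gt0 : forall l, (0 < l)%N -> (0 < n l)%N.
Hypothesis GH : gauss_hermite_rules n Q.

(** Both rules integrate the constant [1] exactly. *)
Lemma quad_diff_cst1 (l : nat) : (1 < l)%N -> quad_app (quad_diff Q l) (fun=> 1) = 0.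
Proof.
case: l => [|[|l]]// _; rewrite quad_diffS.
have E k : quad_app (Q k.+1) (fun=> 1) = \int[@lebesgue_measure R]_x (normal_pdf 0 1 x).
  have [_ _ _ /(_ 1)] := (GH.2 k.+1 isT).
  rewrite size_poly1 => /(_ _); rewrite double_gt0 n_gt0// => /(_ isT).
  under eq_fun do rewrite hornerC.
  by move=> ->; congr (fine _); apply: eq_integral => x _; rewrite hornerC mul1r.
by rewrite !E subrr.
Qed.

Lemma sum_quad_diff (L : nat) (f : R -> R) :
  \sum_(k <- iota 1 L) quad_app (quad_diff Q k) f = quad_app (Q L) f.
Proof.
elim: L => [|L IHL]; first by rewrite big_nil (GH.1) quad_app_nil.
have -> : iota 1 L.+1 = iota 1 L ++ [:: L.+1] by rewrite -[L.+1]addn1 iotaD/= add1n addn1.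
by rewrite big_cat big_seq1 IHL quad_diffS /= addrC subrK.
Qed.

Lemma mem_quad_diff (l : nat) (y : R) : (0 < l)%N ->
  y \in unzip2 (Q l) -> y \in unzip2 (quad_diff Q l).
Proof. by case: l => // l _ yl; rewrite /unzip2 map_cat mem_cat yl. Qed.

Section coordinate.
Variables (d : nat) (j : 'I_d) (Lambda : {fset {ffun 'I_d -> nat}}).
Hypothesis Lambda_gt0 : forall l, l \in Lambda -> forall i, (0 < l i)%N.
Hypothesis Lambda_down : forall l : nat, axis_index j l \in Lambda ->
    forall k : nat, (1 <= k <= l)%N -> axis_index j k \in Lambda.

Lemma axis_index_inj : injective (axis_index j).
Proof. by move=> k l /ffunP/(_ j); rewrite !ffunE eqxx. Qed.

(** Downward closedness makes the levels on the axis an initial segment; [L] is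
    [0] if the axis does not meet the index set. *)
Lemma axis_levels : exists L, forall k, (axis_index j k \in Lambda) = (0 < k <= L)%N.
Proof.
have pos k : axis_index j k \in Lambda -> (0 < k)%N.
  by move=> /Lambda_gt0/(_ j); rewrite ffunE eqxx.
have [ex|nex] := pselect (exists k, axis_index j k \in Lambda); last first.
  exists 0%N => k; rewrite leqn0 lt0n andNb; apply/negbTE/negP => kL.
  by apply: nex; exists k.
have ub k : axis_index j k \in Lambda -> (k <= \max_(l <- enum_fset Lambda) l j)%N.
  move=> kL; have := @leq_bigmax_seq _ (enum_fset Lambda) xpredT
    (fun l : {ffun 'I_d -> nat} => l j) _ kL isT.
  by rewrite ffunE eqxx.
have [L PL maxL] := ex_maxnP ex ub; exists L => k; apply/idP/idP.
  by move=> kL; rewrite pos// maxL.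
exact: Lambda_down PL k.
Qed.

(** For a function of the coordinate [j] alone each summand is a product of
    univariate differences, of which those in the other directions are applied
    to the constant [1].  By [quad_diff_cst1] only indices on the axis
    contribute, and the remaining sum telescopes. *)
Lemma sparse_grid_coord (L : nat) (g : R -> R) :
  (forall k, (axis_index j k \in Lambda) = (0 < k <= L)%N) ->
  exists v : R, quad_app (sparse_grid Q Lambda) (fun x => g (x 0 j)) =
    v * quad_app (Q L) g.
Proof.
move=> HL; pose h i := if i == j then g else fun=> 1.
have gh (x : 'rV[R]_d) : g (x 0 j) = \prod_i h i (x 0 i).
  rewrite (bigD1 j)//= big1 ?mulr1 /h ?eqxx// => i /negbTE ij.
  by rewrite ij.
exists (\prod_(i | i != j) quad_app (quad_diff Q 1) (fun=> 1)).
pose term (l : {ffun 'I_d -> nat}) := \prod_i quad_app (quad_diff Q (l i)) (h i).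
have -> : quad_app (sparse_grid Q Lambda) (fun x => g (x 0 j)) =
    \sum_(l <- enum_fset Lambda) term l.
  rewrite /quad_app /sparse_grid big_flatten big_map; apply: eq_bigr => l _.
  by under eq_bigr do rewrite gh; exact: quad_tensor_prod.
rewrite (bigID (fun l : {ffun 'I_d -> nat} => l == axis_index j (l j)))/= [X in _ + X]big_seq_cond.
rewrite [X in _ + X]big1 ?addr0; last first.
  move=> l /andP[lL]; apply: contra_neq_eq => tl.
  have li i : i != j -> l i = 1%N.
    move=> ij; apply/eqP; rewrite eqn_leq Lambda_gt0// andbT leqNgt.
    apply/negP => l2; move/negP: tl; apply; rewrite /term (bigD1 i)//=.
    by rewrite /h (negbTE ij) quad_diff_cst1// mul0r.
  by apply/ffunP => i; rewrite ffunE; case: eqVneq => [->//|/li].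
rewrite -big_filter (perm_big [seq axis_index j k | k <- iota 1 L]); last first.
  apply: uniq_perm.
  - by rewrite filter_uniq// fset_uniq.
  - by rewrite map_inj_uniq ?iota_uniq//; exact: axis_index_inj.
  - move=> l; rewrite mem_filter; apply/andP/mapP.
      move=> [/eqP lj lL]; exists (l j) => //.
      by rewrite mem_iota add1n ltnS -HL -lj.
    move=> [k]; rewrite mem_iota add1n ltnS -HL => kL ->.
    by split=> //; rewrite [axis_index j k j]ffunE eqxx.
rewrite big_map -sum_quad_diff mulr_sumr; apply: eq_bigr => k _.
rewrite /term (bigD1 j)//= mulrC /axis_index ffunE eqxx /h eqxx; congr (_ * _).
by apply: eq_bigr => i /negbTE ij; rewrite ffunE ij.
Qed.

(** The tensor product of the index with level [L] in direction [j] and level [1]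
    elsewhere contains a copy of the nodes of [Q L]. *)
Lemma num_evals_ge (L : nat) : (0 < L)%N -> axis_index j L \in Lambda ->
  (n L <= num_evals (sparse_grid Q Lambda))%N.
Proof.
move=> L0 LL.
have [sL uL _ _] := GH.2 _ L0; have [s1 _ _ _] := GH.2 1%N isT.
have [y0 y0Q] : exists y, y \in unzip2 (Q 1).
  have := n_gt0 (ltn0Sn 0); rewrite -s1.
  by case: (Q 1) => // -[w y] q _; exists y; rewrite inE eqxx.
pose pt (y : R) : 'rV[R]_d := \row_i if i == j then y else y0.
rewrite -sL -(size_map snd) -(size_map pt); apply: uniq_leq_size.
  rewrite map_inj_uniq// => y z /rowP/(_ j).
  by rewrite !mxE eqxx.
move=> _ /mapP[y yQ ->]; rewrite mem_undup /sparse_grid /unzip2 map_flatten.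
apply/flatten_mapP; exists (quad_tensor (fun i => quad_diff Q (axis_index j L i))).
  by apply/mapP; exists (axis_index j L).
apply: mem_quad_tensor => i; rewrite mxE ffunE.
by case: eqP => _; exact: mem_quad_diff.
Qed.

End coordinate.

End quadrature_theory.

(** * Sobolev functions of one coordinate *)

Section coordinate_sobolev.
Context {R : realType}.
Local Notation leb := (@lebesgue_measure R).
Variables (d : nat) (j : 'I_d).

Lemma integral_sqr_coord_le (h : R -> R) (B : R) : continuous h ->
  (forall t, `|h t| <= B) ->
  (\int[lebesgue_rV R d]_x (h (x 0 j) ^+ 2 * gauss_rho x)%:E <= (B ^+ 2)%:E)%E.
Proof.
move=> ch hB.
have mh : measurable_fun setT (fun t => h t ^+ 2).
  by apply: measurable_funX; exact: continuous_measurable_fun.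
rewrite (@integral_gauss_rho_coord _ _ j (fun t => h t ^+ 2))//; last first.
  by move=> t; exact: sqr_ge0.
apply: (@le_trans _ _ (\int[leb]_t ((B ^+ 2)%:E * (normal_pdf 0 1 t)%:E))%E).
  apply: ge0_le_integral => //.
  - by move=> t _; rewrite lee_fin mulr_ge0 ?sqr_ge0 ?normal_pdf_ge0.
  - apply/measurable_EFinP; apply: measurable_funM; first exact: mh.
    exact: measurable_normal_pdf.
  - apply/measurable_EFinP; apply: measurable_funM => //.
    exact: measurable_normal_pdf.
  move=> t _; rewrite lee_fin ler_wpM2r ?normal_pdf_ge0//.
  by rewrite -[h t ^+ 2]real_normK ?num_real// lerXn2r ?nnegrE// (le_trans _ (hB t)).
rewrite ge0_integralZl_EFin ?sqr_ge0//.
- by rewrite integral_normal_pdf mule1.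
- by move=> t _; rewrite lee_fin normal_pdf_ge0.
- by apply/measurable_EFinP; exact: measurable_normal_pdf.
Qed.

Lemma coord_L2 (h : R -> R) (B : R) : continuous h -> (forall t, `|h t| <= B) ->
  gauss_L2 (fun x : 'rV[R]_d => h (x 0 j)).
Proof.
move=> ch hB; split.
  apply: (measurableT_comp _ (measurable_rV_coord j)).
  exact: continuous_measurable_fun.
exact: le_lt_trans (integral_sqr_coord_le ch hB) (ltry _).
Qed.

Lemma gauss_L2norm_sqr (f : 'rV[R]_d -> R) :
  gauss_L2norm f ^+ 2 = \int[lebesgue_rV R d]_x (f x ^+ 2 * gauss_rho x).
Proof.
rewrite /gauss_L2norm sqr_sqrtr// Rintegral_ge0// => x _.
by rewrite mulr_ge0 ?sqr_ge0 ?gauss_rho_ge0.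
Qed.

Lemma coord_L2norm_le (h : R -> R) (B : R) : continuous h -> (forall t, `|h t| <= B) ->
  gauss_L2norm (fun x : 'rV[R]_d => h (x 0 j)) ^+ 2 <= B ^+ 2.
Proof.
move=> ch hB; rewrite gauss_L2norm_sqr /Rintegral.
rewrite -lee_fin fineK; first exact: integral_sqr_coord_le.
rewrite ge0_fin_numE; first exact: le_lt_trans (integral_sqr_coord_le ch hB) (ltry _).
by apply: integral_ge0 => x _; rewrite lee_fin mulr_ge0 ?sqr_ge0 ?gauss_rho_ge0.
Qed.

Variable alpha : nat.

(** The multi-indices of the derivatives that do not annihilate functions of
    the coordinate [j]. *)
Definition on_axis (r : {ffun 'I_d -> 'I_alpha.+1}) : bool :=
  [forall i, (i != j) ==> (r i == ord0)].

Lemma count_multi_partial (r : 'I_d -> nat) (p : pred 'I_d) :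
  count p (flatten [seq nseq (r i) i | i <- enum 'I_d]) = (\sum_(i | p i) r i)%N.
Proof.
rewrite count_flatten -map_comp sumnE big_map big_enum [RHS]big_mkcond/=.
by apply: eq_bigr => i _; rewrite count_nseq; case: (p i); rewrite ?mul1n.
Qed.

Variable g : nat -> R -> R.
Hypothesis dg : forall k t, (k < alpha)%N -> is_derive t (1 : R) (g k) (g k.+1 t).
Hypothesis cg : forall k, continuous (g k).
Variable B : R.
Hypothesis gB : forall k t, (k <= alpha)%N -> `|g k t| <= B.

Definition coord_deriv (r : {ffun 'I_d -> 'I_alpha.+1}) (x : 'rV[R]_d) : R :=
  if on_axis r then g (r j) (x 0 j) else 0.

Lemma coord_deriv_L2 r : gauss_L2 (coord_deriv r).
Proof.
rewrite /coord_deriv; case: (on_axis r).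
  by apply: (coord_L2 (B := B)) => // t; apply: gB; rewrite -ltnS.
apply: (coord_L2 (h := cst 0) (B := 0)); first exact: cst_continuous.
by move=> t; rewrite normr0.
Qed.

Lemma coord_derivP (r : {ffun 'I_d -> 'I_alpha.+1}) :
  weak_derivative (fun i => r i) (fun x => g 0 (x 0 j)) (coord_deriv r).
Proof.
move=> phi tphi; pose s := flatten [seq nseq (r i) i | i <- enum 'I_d].
have sj : count (pred1 j) s = r j by rewrite count_multi_partial big_pred1_eq.
have ss : size s = (\sum_i r i)%N by rewrite -count_predT count_multi_partial.
have al : all (pred1 j) s = on_axis r.
  apply/allP/forallP => [sr i|rs i /flatten_mapP[k _]].
    apply/implyP => ij; apply: contraT => ri.
    move/eqP: ij; case; apply/eqP; apply: sr.
    apply/flatten_mapP; exists i; rewrite ?mem_enum//.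
    by rewrite mem_nseq eqxx andbT lt0n.
  rewrite mem_nseq => /andP[rk /eqP ->] /=; apply: contraT => kj.
  by have := rs k; rewrite kj/= => /eqP rk0; rewrite rk0 in rk.
rewrite /multi_partial (integral_partials (k := 0) dg cg tphi); last first.
  by rewrite -/s add0n sj -ltnS.
rewrite -/s ss al /coord_deriv add0n; case: (boolP (on_axis r)) => // /forallP rs.
rewrite (bigD1 j)//= big1 ?addn0// => i ij.
by have := rs i; rewrite ij => /eqP ->.
Qed.

Definition coord_sobolev : @gauss_sobolev R d alpha :=
  GaussSobolev (continuous_coord (j := j) cg (k := 0)) coord_deriv_L2 coord_derivP.

(** Only [alpha + 1] of the derivatives do not vanish identically. *)
Lemma coord_sobolev_norm_le : 0 <= B ->
  sobolev_norm coord_sobolev <= Num.sqrt alpha.+1%:R * B.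
Proof.
move=> B0; rewrite -[X in _ * X]ger0_norm// -sqrtr_sqr -sqrtrM//.
rewrite ler_wsqrtr// (bigID on_axis)/= [X in _ + X]big1 ?addr0; last first.
  move=> r nr; rewrite gauss_L2norm_sqr /coord_deriv (negbTE nr).
  rewrite /Rintegral; under eq_integral do rewrite expr0n mul0r.
  by rewrite integral0.
pose e (k : 'I_alpha.+1) : {ffun 'I_d -> 'I_alpha.+1} :=
  [ffun i => if i == j then k else ord0].
rewrite (reindex_onto e (fun r => r j)); last first.
  move=> r /forallP rs; apply/ffunP => i; rewrite ffunE; case: eqVneq => [->//|ij].
  by have := rs i; rewrite ij => /eqP ->.
apply: (@le_trans _ _ (\sum_(k < alpha.+1) B ^+ 2)); last first.
  by rewrite sumr_const card_ord mulr_natl.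
rewrite big_mkcond/=; apply: ler_sum => k _; case: ifP => [/andP[ek _]|_]; last first.
  exact: sqr_ge0.
rewrite /coord_deriv ek; apply: coord_L2norm_le => // t.
by apply: gB; rewrite -ltnS.
Qed.

Hypothesis g_ge0 : forall t, 0 <= g 0 t.

Lemma gauss_int_coord :
  (gauss_int coord_sobolev)%:E = (\int[leb]_t (g 0 t * normal_pdf 0 1 t)%:E)%E.
Proof.
have mg : measurable_fun setT (g 0) by exact: continuous_measurable_fun.
rewrite /gauss_int /Rintegral integral_gauss_rho_coord// fineK//.
rewrite ge0_fin_numE; last first.
  by apply: integral_ge0 => t _; rewrite lee_fin mulr_ge0 ?normal_pdf_ge0.
apply: (@le_lt_trans _ _ (\int[leb]_t (B%:E * (normal_pdf 0 1 t)%:E))%E).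
  apply: ge0_le_integral => //.
  - by move=> t _; rewrite lee_fin mulr_ge0 ?normal_pdf_ge0.
  - apply/measurable_EFinP; apply: measurable_funM; first exact: mg.
    exact: measurable_normal_pdf.
  - apply/measurable_EFinP; apply: measurable_funM => //.
    exact: measurable_normal_pdf.
  move=> t _; rewrite lee_fin ler_wpM2r ?normal_pdf_ge0//.
  exact: le_trans (ler_norm _) (gB t (leq0n _)).
rewrite ge0_integralZl_EFin//.
- by rewrite integral_normal_pdf mule1 ltry.
- by move=> t _; rewrite lee_fin normal_pdf_ge0.
- by apply/measurable_EFinP; exact: measurable_normal_pdf.
- exact: le_trans (normr_ge0 _) (gB 0 (leq0n _)).
Qed.

Lemma coord_sobolev_neq0 : 0 < gauss_int coord_sobolev ->
  exists x, coord_sobolev x != 0.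
Proof.
move=> I0; apply: contrapT => /forallNP F0; move: I0.
rewrite /gauss_int /Rintegral; under eq_integral => x _.
  have /negP := F0 x; rewrite negbK => /eqP ->; rewrite mul0r; over.
by rewrite integral0 ltxx.
Qed.

(** Otherwise the squared function has Gaussian integral [0], and integrating
    [g <= g^2 / (2 I) + I / 2], where [I > 0] is the integral of [g], yields
    [I <= I / 2]. *)
Lemma coord_sobolev_norm_gt0 : 0 < gauss_int coord_sobolev ->
  0 < sobolev_norm coord_sobolev.
Proof.
set I := gauss_int _ => I0.
pose r0 : {ffun 'I_d -> 'I_alpha.+1} := [ffun=> ord0].
have E0 : coord_deriv r0 = (fun x => g 0 (x 0 j)).
  apply/funext => x; rewrite /coord_deriv ifT ?ffunE//.
  by apply/forallP => i; rewrite ffunE eqxx implybT.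
have mg : measurable_fun setT (g 0) by exact: continuous_measurable_fun.
have mg2 : measurable_fun setT (fun t => g 0 t ^+ 2) by exact: measurable_funX.
have mpdf : measurable_fun setT (normal_pdf 0 (1 : R)) by exact: measurable_normal_pdf.
pose J := (\int[leb]_t (g 0 t ^+ 2 * normal_pdf 0 1 t)%:E)%E.
have JE : (gauss_L2norm (coord_deriv r0) ^+ 2)%:E = J.
  rewrite E0 gauss_L2norm_sqr /Rintegral fineK; last first.
    rewrite ge0_fin_numE.
      apply: le_lt_trans (integral_sqr_coord_le _ _) (ltry _); first exact: cg.
      by move=> t; exact: gB.
    by apply: integral_ge0 => x _; rewrite lee_fin mulr_ge0 ?sqr_ge0 ?gauss_rho_ge0.
  by rewrite (@integral_gauss_rho_coord _ _ j (fun t => g 0 t ^+ 2))// => t; exact: sqr_ge0.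
have J0 : 0 < gauss_L2norm (coord_deriv r0) ^+ 2.
  rewrite lt_neqAle sqr_ge0 andbT eq_sym; apply/negP => /eqP n0.
  have J0 : J = 0%E by rewrite -JE n0.
  have : (I%:E <= (I / 2)%:E)%E.
    rewrite {1}gauss_int_coord.
    apply: (@le_trans _ _ (\int[leb]_t ((1 / (2 * I))%:E * (g 0 t ^+ 2 * normal_pdf 0 1 t)%:E
              + (I / 2)%:E * (normal_pdf 0 1 t)%:E))%E).
      apply: ge0_le_integral => //.
      - by move=> t _; rewrite lee_fin mulr_ge0 ?normal_pdf_ge0.
      - by apply/measurable_EFinP; apply: measurable_funM.
      - apply: emeasurable_funD; apply/measurable_EFinP; apply: measurable_funM => //.
        by apply: measurable_funM.
      move=> t _; rewrite -!EFinM -EFinD lee_fin mulrA -mulrDl.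
      rewrite ler_wpM2r ?normal_pdf_ge0//.
      have -> : 1 / (2 * I) * g 0 t ^+ 2 + I / 2 = g 0 t + (g 0 t - I) ^+ 2 / (2 * I).
        by field; rewrite gt_eqF.
      by rewrite lerDl divr_ge0 ?sqr_ge0// mulr_ge0// ltW.
    have I20 : 0 <= 1 / (2 * I) by rewrite divr_ge0// mulr_ge0// ltW.
    have I2 : 0 <= I / 2 by rewrite divr_ge0// ltW.
    rewrite ge0_integralD//.
    - rewrite !ge0_integralZl_EFin//; first by rewrite -/J J0 mule0 add0e integral_normal_pdf mule1.
      + by move=> t _; rewrite lee_fin normal_pdf_ge0.
      + exact/measurable_EFinP.
      + by move=> t _; rewrite lee_fin mulr_ge0 ?sqr_ge0 ?normal_pdf_ge0.
      + by apply/measurable_EFinP; apply: measurable_funM.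
    - by move=> t _; rewrite -EFinM lee_fin mulr_ge0// mulr_ge0 ?sqr_ge0 ?normal_pdf_ge0.
    - apply/measurable_EFinP; apply: measurable_funM => //.
      by apply: measurable_funM.
    - by move=> t _; rewrite -EFinM lee_fin mulr_ge0// normal_pdf_ge0.
    - by apply/measurable_EFinP; apply: measurable_funM.
  by rewrite lee_fin; apply/negP; rewrite -ltNge ltr_pdivrMr// ltr_pMr// ltr1n.
rewrite sqrtr_gt0 (bigD1 r0)//= ltr_pwDl// sumr_ge0// => r _; exact: sqr_ge0.
Qed.

End coordinate_sobolev.

(** * The lower bound *)

Lemma powR_neg_half (R : realType) (a n : nat) : (0 < n)%N ->
  n%:R `^ (- (a%:R / 2)) = (Num.sqrt n%:R ^+ a)^-1 :> R.
Proof.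
move=> n0; rewrite powRN mulrC powRrM powR12_sqrt// powR_mulrn//.
Qed.

Theorem theorem3p1 (R : realType) (alpha : nat) (alpha_gt0 : (0 < alpha)%N) :
  exists c : R, 0 < c /\
    forall (d : nat) (n : nat -> nat) (Q : nat -> seq (R * R))
      (Lambda : {fset {ffun 'I_d -> nat}}),
    (0 < d)%N ->
    (forall l, (0 < l)%N -> (0 < n l)%N) ->
    gauss_hermite_rules n Q ->
    Lambda != fset0 ->
    (forall l, l \in Lambda -> forall j, (0 < l j)%N) ->
    down_closed_one_direction Lambda ->
    ((c * (num_evals (sparse_grid Q Lambda))%:R `^ (- (alpha%:R / 2)))%:E <=
     ereal_sup [set (`|gauss_int F - quad_app (sparse_grid Q Lambda) F| /
                       sobolev_norm F)%:E
               | F in [set F : @gauss_sobolev R d alpha |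
                        exists x, F x != 0%R]])%E.
Proof.
have [c [C [c0 C0 fool]]] := fooling_function R alpha.
pose D := Num.sqrt alpha.+1%:R * C.
have D0 : 0 < D by rewrite mulr_gt0// sqrtr_gt0 ltr0n.
exists (c / D); split; first exact: divr_gt0.
move=> d n Q Lambda _ n_gt0 GH _ Lambda_gt0 [j Lambda_down].
have [L HL] := axis_levels Lambda_gt0 Lambda_down.
set S := sparse_grid Q Lambda; set N := num_evals S.
(* The fooling function for one node serves when the axis contributes nothing. *)
pose m := if L == 0%N then 1%N else n L.
have m0 : (0 < m)%N by rewrite /m; case: (posnP L) => // L0; exact: n_gt0.
have [g [dg cg groot g_ge0 [gB gint]]] := fool m m0.
have [v SF] := sparse_grid_coord n_gt0 GH Lambda_gt0 (g 0%N) HL.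
have S0 : quad_app S (fun x : 'rV[R]_d => g 0%N (x 0 j)) = 0.
  rewrite /S SF; case: (posnP L) @m groot {m0 gB} => [->|L0] m groot.
    by rewrite (GH.1) quad_app_nil mulr0.
  rewrite /quad_app big_seq big1 ?mulr0// => wx wxQ.
  rewrite groot ?mulr0//; have [_ _ <- _] := GH.2 L L0.
  exact: map_f.
have Nm : (0 < N)%N -> (m <= N)%N.
  move=> N0; rewrite /m; case: (posnP L) => // L0.
  by apply: (num_evals_ge n_gt0 GH (j := j)) => //; rewrite HL L0 leqnn.
set sm := Num.sqrt m%:R ^+ alpha in gB.
have sm0 : 0 < sm by rewrite exprn_gt0// sqrtr_gt0 ltr0n.
have B0 : 0 <= C * sm by rewrite mulr_ge0 ?ltW.
pose F : gauss_sobolev d alpha := coord_sobolev j dg cg gB.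
have IF : c <= gauss_int F.
  by rewrite -lee_fin gauss_int_coord.
have IF0 : 0 < gauss_int F by exact: lt_le_trans IF.
have norm0 : 0 < sobolev_norm F by exact: coord_sobolev_norm_gt0.
have normD : sobolev_norm F <= D * sm.
  by rewrite /D -mulrA; exact: coord_sobolev_norm_le.
apply: (@le_trans _ _ (`|gauss_int F - quad_app S F| / sobolev_norm F)%:E); last first.
  by apply: ereal_sup_ubound; exists F => //; exact: coord_sobolev_neq0.
rewrite lee_fin [quad_app S F]S0 subr0 gtr0_norm//.
have [N0|N0] := posnP N.
  rewrite N0 powR0 ?mulr0 ?divr_ge0 ?ltW//.
  by rewrite oppr_eq0 mulf_eq0 invr_eq0 !pnatr_eq0 negb_or -lt0n alpha_gt0.
rewrite powR_neg_half//.
apply: (@le_trans _ _ (c / (D * sm))).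
  rewrite [(D * sm)^-1]invfM [leRHS]mulrA ler_wpM2l ?(ltW (divr_gt0 _ _))//.
  rewrite lef_pV2 ?posrE//; last by rewrite exprn_gt0// sqrtr_gt0 ltr0n.
  by rewrite lerXn2r ?nnegrE ?sqrtr_ge0// ler_wsqrtr// ler_nat Nm.
apply: ler_pM => //; [exact: ltW| |].
  by rewrite invr_ge0 mulr_ge0 ?ltW.
by rewrite lef_pV2 ?posrE// mulr_gt0.
Qed.
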